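(* Fix $d$ and $C$. Let $\mathcal{G}\in\mathscr{F}_{n,d,C}$ have major subgraphs $\mathcal{G}(a_i,b_i,c_i;m_i)$, $i=1,\ldots,t$, and let $L$ and $\ell$ be the maximum and minimum of $\{a_ib_ic_i: i=1,\ldots,t\}$, respectively. Then, as $n\to\infty$, $$(1+o(1))\frac{\ell\pi^2}{n^2}\le\mu(\mathcal{G})\le(1+o(1))\frac{L\pi^2}{n^2}.$$
   Context: $\mu$ is the second smallest eigenvalue of the Laplacian (degree matrix minus adjacency matrix). The sequential join $G_1+\cdots+G_k$ joins every vertex of $G_i$ to every vertex of $G_{i+1}$. $\mathcal{G}(a,b,c;m)$ is the sequential join of the $3m$ cliques $K_a,K_b,K_c,\ldots,K_a,K_b,K_c$ (its cells). A graph $\mathcal{G}$ belongs to $\mathscr{F}_{n,d,C}$ if (i) there exist positive integers $t\le C$, $m_1,\ldots,m_t$, $a_1,b_1,c_1,\ldots,a_t,b_t,c_t$ with $a_i+b_i+c_i=d+1$, and graphs $H_0,\ldots,H_t$ with $\sum_{i=0}^t|V(H_i)|\le C$ and $\sum_{i=1}^t m_i(d+1)+\sum_{i=0}^t|V(H_i)|=n$; and (ii) $\mathcal{G}$ is connected and obtained from the disjoint union $H_0\cup\mathcal{G}_1\cup H_1\cup\cdots\cup\mathcal{G}_t\cup H_t$, with $\mathcal{G}_i=\mathcal{G}(a_i,b_i,c_i;m_i)$, by adding edges between arbitrary vertices of the first cell of $\mathcal{G}_i$ and arbitrary vertices of $H_{i-1}$, and between arbitrary vertices of the last cell of $\mathcal{G}_i$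 and arbitrary vertices of $H_i$. The $\mathcal{G}_i$ are the major subgraphs of $\mathcal{G}$. *)

(* Defs.v *)
From HB Require Import structures.
From mathcomp Require Import all_boot all_order all_algebra.
From mathcomp Require Import polyrcf.
From mathcomp Require Import all_classical all_reals all_analysis.

Set Implicit Arguments.
Unset Strict Implicit.
Unset Printing Implicit Defensive.

Import Order.TTheory GRing.Theory Num.Theory.
Import numFieldNormedType.Exports.

(* Finite simple graphs.  The vertex set may be empty: the graphs H_i in the
   definition of the family F_{n,d,C} below are allowed to be empty. *)
Record sgraph := SGraph {
  vertex :> finType;
  adj : rel vertex;
  adj_sym : symmetric adj;
  adj_irr : irreflexive adj
}.
Arguments adj {s}.

Definition sg_connected (G : sgraph) : Prop := forall x y : G, connect adj x y.

Section Laplacian.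
Local Open Scope ring_scope.

Definition degree (G : sgraph) (x : G) : nat := #|[pred y | adj x y]|.

(* Rows and columns are indexed through the enumeration of the vertices. *)
Definition adjacency_mx (R : nzRingType) (G : sgraph) : 'M[R]_#|G| :=
  \matrix_(i, j) (adj (enum_val i) (enum_val j))%:R.

Definition degree_mx (R : nzRingType) (G : sgraph) : 'M[R]_#|G| :=
  diag_mx (\row_i (degree (enum_val i))%:R).

Definition laplacian (R : nzRingType) (G : sgraph) : 'M[R]_#|G| :=
  degree_mx R G - adjacency_mx R G.

(* [rootsR p] is the increasing list of the distinct roots of p, so
   [eigenvalues A] is the nondecreasing list of the eigenvalues of A in R,
   each repeated according to its (algebraic) multiplicity. *)
Definition eigenvalues (R : rcfType) (n : nat) (A : 'M[R]_n) : seq R :=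
  flatten [seq nseq (mup x (char_poly A)) x | x <- rootsR (char_poly A)].

(* The second smallest Laplacian eigenvalue (the default 0 is only reached by
   graphs with fewer than two vertices). *)
Definition mu (R : rcfType) (G : sgraph) : R :=
  nth 0 (eigenvalues (laplacian R G)) 1.

End Laplacian.

Section Constructions.

Section Clique.
Variable n : nat.

Definition clique_adj : rel 'I_n := fun x y => x != y.

Lemma clique_adj_sym : symmetric clique_adj.
Proof. by move=> x y; rewrite /clique_adj eq_sym. Qed.

Lemma clique_adj_irr : irreflexive clique_adj.
Proof. by move=> x; rewrite /clique_adj eqxx. Qed.

Definition clique := SGraph clique_adj_sym clique_adj_irr.

End Clique.

Section Families.
Variables (k : nat) (G : 'I_k -> sgraph).

(* On {i : 'I_k & G i}, u and v have the same tag exactly when they lie in the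
   same G i; [tagged_as u v] is then v seen as a vertex of that G i. *)
Definition union_adj : rel {i : 'I_k & vertex (G i)} := fun u v =>
  (tag u == tag v) && adj (tagged u) (tagged_as u v).

Lemma union_adj_sym : symmetric union_adj.
Proof.
move=> [i x] [j y]; rewrite /union_adj /= eq_sym.
case: eqP => //= eji; subst j.
by rewrite !tagged_asE adj_sym.
Qed.

Lemma union_adj_irr : irreflexive union_adj.
Proof. by move=> [i x]; rewrite /union_adj /= tagged_asE adj_irr andbF. Qed.

Definition disjoint_union := SGraph union_adj_sym union_adj_irr.

Definition seq_join_adj : rel {i : 'I_k & vertex (G i)} := fun u v =>
  [|| union_adj u v,
      tag v == (tag u).+1 :> nat |
      tag u == (tag v).+1 :> nat].

Lemma seq_join_adj_sym : symmetric seq_join_adj.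
Proof.
move=> u v; rewrite /seq_join_adj union_adj_sym.
by congr (_ || _); rewrite orbC.
Qed.

Lemma seq_join_adj_irr : irreflexive seq_join_adj.
Proof.
move=> u; rewrite /seq_join_adj union_adj_irr /= orbb.
by apply/negbTE; rewrite neq_ltn ltnSn.
Qed.

Definition seq_join := SGraph seq_join_adj_sym seq_join_adj_irr.

End Families.

Section DisjointUnion2.
Variables G H : sgraph.

Definition union2_adj : rel (vertex G + vertex H)%type := fun u v =>
  match u, v with
  | inl x, inl y => adj x y
  | inr x, inr y => adj x y
  | _, _ => false
  end.

Lemma union2_adj_sym : symmetric union2_adj.
Proof. by case=> x [] y //=; rewrite adj_sym. Qed.

Lemma union2_adj_irr : irreflexive union2_adj.
Proof. by case=> x /=; rewrite adj_irr. Qed.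

Definition disjoint_union2 := SGraph union2_adj_sym union2_adj_irr.

End DisjointUnion2.

(* The sequential join of the 3m cliques K_a, K_b, K_c, ..., K_a, K_b, K_c; a
   vertex [Tagged _ x] with tag j lies in the cell number j, 0 <= j < 3m. *)
Definition Gabc (a b c m : nat) : sgraph :=
  seq_join (fun j : 'I_(3 * m) => clique (nth 0 [:: a; b; c] (j %% 3))).

End Constructions.

Section Family.

Section Base.
Variables (t : nat) (m a b c : 'I_t -> nat) (H : 'I_t.+1 -> sgraph).

Definition base_graph : sgraph :=
  disjoint_union2 (disjoint_union H)
                  (disjoint_union (fun i => Gabc (a i) (b i) (c i) (m i))).

(* The major subgraphs are numbered from 0 here instead of
   from 1: the one with index i : 'I_t sits between H_i and H_(i+1).  Its first cell
   may be attached to H_i and its last cell, of index 3 * m i - 1, to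
   H_(i+1). *)
Definition may_attach (x : disjoint_union H)
    (y : disjoint_union (fun i => Gabc (a i) (b i) (c i) (m i))) : bool :=
  let k := tag x in let i := tag y in let cell := tag (tagged y) in
  (k == i :> nat) && (cell == 0 :> nat) ||
  (k == i.+1 :> nat) && (cell.+1 == 3 * m i :> nat).

Definition may_add (u v : base_graph) : bool :=
  match u, v with
  | inl x, inr y => may_attach x y
  | inr y, inl x => may_attach x y
  | _, _ => false
  end.

End Base.

(* A witness that G belongs to F_{n,d,C}; it records
   its major subgraphs.  G is identified, through the bijection [emb], with a
   graph obtained from [base_graph] by adding edges allowed by [may_add]. *)
Record family_decomposition (n d C : nat) (G : sgraph) := FamilyDecomposition {
  nmajor : nat;
  len : 'I_nmajor -> nat;
  pa : 'I_nmajor -> nat;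
  pb : 'I_nmajor -> nat;
  pc : 'I_nmajor -> nat;
  minor : 'I_nmajor.+1 -> sgraph;
  emb : base_graph len pa pb pc minor -> G;
  nmajor_gt0 : 0 < nmajor;
  nmajor_le : nmajor <= C;
  params_gt0 : forall i, [/\ 0 < len i, 0 < pa i, 0 < pb i & 0 < pc i];
  params_sum : forall i, pa i + pb i + pc i = d.+1;
  minor_le : \sum_i #|minor i| <= C;
  order_eq : (\sum_i len i * d.+1) + (\sum_i #|minor i|) = n;
  G_connected : sg_connected G;
  emb_bij : bijective emb;
  emb_adj : forall u v, adj u v -> adj (emb u) (emb v);
  emb_new : forall u v, adj (emb u) (emb v) -> adj u v || may_add u v
}.

Definition abc (n d C : nat) (G : sgraph) (D : family_decomposition n d C G)
    (i : 'I_(nmajor D)) : nat := pa i * pb i * pc i.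

End Family.

Arguments abc {n d C G} D i.

Definition is_maximum (I : Type) (f : I -> nat) (M : nat) : Prop :=
  (exists i, f i = M) /\ (forall i, f i <= M).

Definition is_minimum (I : Type) (f : I -> nat) (M : nat) : Prop :=
  (exists i, f i = M) /\ (forall i, M <= f i).

(* Main.v *)
Require Import Defs.
From HB Require Import structures.
From mathcomp Require Import all_boot all_order all_algebra.
From mathcomp Require Import polyrcf complex spectral sesquilinear.
From mathcomp Require Import ring lra zify.
Import Order.TTheory GRing.Theory Num.Theory.

(* By the variational principle, [mu] is the best constant in
   [mu * sum f^2 <= energy f] over the functions of zero sum.  The cells of a
   period are in series with conductances ab, bc, ca, hence a period has
   conductance abc/(d+1) and mass d+1: the graph behaves like a path of about
   n/(d+1) vertices, whose eigenvalue is pi^2 (d+1)^2 / n^2.  Upper bound: test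
   with the cosine eigenfunction of the path, interpolated inside each period
   according to the potential drops and constant around each H_i.  Lower bound:
   replace f by its averages over the first cells of the periods, glued so that
   the increments across the H_i are dropped; since only boundedly many bounded
   blocks separate the major subgraphs, this changes f by
   O(sqrt (energy f)) uniformly, and the sharp discrete Poincare inequality on
   the path applies to the glued sequence. *)

Set Implicit Arguments.
Unset Strict Implicit.
Unset Printing Implicit Defensive.
Local Open Scope ring_scope.

(** * Spectra of real symmetric matrices *)

(** Ignoring the H_i is affordable by orders of magnitude. With E the energy of f, the bound on the
    sum of f^2 has a main term of order n^2 E, whereas an O(sqrt E) error at each of n vertices
    contributes O(n E), and so does the centred glued sequence at the boundedly many vertices in
    excess of one period per path vertex. Cross terms are absorbed with a fixed e by [sqr_add_le];
    the thresholds on n then depend only on d, C and e, which makes the o(1) uniform over the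
    family. Major subgraphs may conduct differently: the lower bound keeps only that a period
    conducts at least l/(d+1), the upper bound that it conducts at most L/(d+1), hence two
    constants. The variational principle has to start from a list of roots of a characteristic
    polynomial. The matrix is diagonalised by a unitary over [R[i]], so quadratic forms are taken at
    complex vectors, and real functions are recovered as real and imaginary parts. *)

Lemma char_poly_similar (F : fieldType) n (P A B : 'M[F]_n) :
  P \in unitmx -> P *m A = B *m P -> char_poly A = char_poly B.
Proof.
move=> uP PA; have: map_mx polyC P *m char_poly_mx A = char_poly_mx B *m map_mx polyC P.
  by rewrite /char_poly_mx mulmxBr mulmxBl -!map_mxM PA scalar_mxC.
move=> /(congr1 determinant); rewrite !det_mulmx mulrC => /mulIf; apply.
by rewrite det_map_mx polyC_eq0 -unitfE -unitmxE.
Qed.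

Section Eigenvalues.
Local Open Scope sesquilinear_scope.
Variable R : rcfType.

Lemma flatten_nseq_sorted (m : R -> nat) (s : seq R) :
  sorted <%R s -> sorted <=%R (flatten [seq nseq (m x) x | x <- s]).
Proof.
have mem_le (x : R) (r : seq R) : all (>= x) r ->
    all (>= x) (flatten [seq nseq (m y) y | y <- r]).
  elim: r => //= y r IH /andP[xy /IH ar]; rewrite all_cat ar andbT.
  by apply/allP => z /nseqP[-> _].
elim: s => //= x s IH xs.
have /IH ss : sorted <%R s := path_sorted xs.
move: xs; rewrite lt_path_sortedE => /andP[/allP sx _].
have /mem_le lx : all (>= x) s by apply/allP => y /sx/ltW.
elim: (m x) => //= k IHk; rewrite le_path_sortedE IHk andbT.
rewrite all_cat lx andbT; apply/allP => z /nseqP[-> _]; exact: lexx.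
Qed.

Lemma eigenvalues_sorted n (A : 'M[R]_n) : sorted <=%R (eigenvalues A).
Proof. exact/flatten_nseq_sorted/sorted_roots. Qed.

(** Compares multiplicities: each x occurs in [eigenvalues A] as often as it is a root of the
    characteristic polynomial, and its multiplicity in a product of linear factors is its count in
    [s]. *)
Lemma eigenvalues_perm n (A : 'M[R]_n) (s : seq R) :
  char_poly A = \prod_(x <- s) ('X - x%:P) -> perm_eq (eigenvalues A) s.
Proof.
move=> eA; apply/allP => /= x _; apply/eqP.
rewrite -(mu_prod_XsubC x s) -eA /eigenvalues count_flatten -map_comp.
have p0 : char_poly A != 0 by rewrite monic_neq0 // char_poly_monic.
rewrite sumnE big_map.
have ur : uniq (rootsR (char_poly A)) := uniq_roots _ _ _.
have [rx|nrx] := boolP (x \in rootsR (char_poly A)).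
  rewrite (bigD1_seq x) //= big1 ?addn0 => [|y /negbTE yx];
    by rewrite /= count_nseq /= ?eqxx ?mul1n // yx.
rewrite big_seq big1 => [|y ry]; last first.
  by rewrite /= count_nseq /=; case: eqVneq ry nrx => // -> ->.
apply/esym/mupNroot; apply: contra nrx.
by have := roots_on_rootsR p0 x; rewrite in_itv /= => <-.
Qed.

(** A real symmetric matrix is Hermitian over [R[i]], so its spectral diagonal is real; the
    factorization of the characteristic polynomial then descends to [R] by injectivity and ties the
    roots to [d]. *)
Lemma symmetric_spectral n (A : 'M[R]_n) : A^T = A ->
  exists (P : 'M[R[i]]_n) (d : 'I_n -> R),
    [/\ P \is unitarymx,
        map_mx (real_complex R) A =
          P ^t* *m diag_mx (\row_i (d i)%:C%C) *m P &
        perm_eq (eigenvalues A) (codom d)].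
Proof.
move=> sA; set AC := map_mx _ A.
have symA : AC \is symmetricmx.
  by apply/is_hermitianmxP; rewrite expr0 scale1r map_mx_id // /AC map_trmx sA.
have realA : AC \is a mxOver Num.real.
  by apply/mxOverP => i j; rewrite mxE; apply/complex_realP; exists (A i j).
have hA := realsym_hermsym symA realA.
have /orthomx_spectralP := hermitian_normalmx hA.
set P := spectralmx AC; set sp := spectral_diag AC => eA.
have uP : P \is unitarymx := spectral_unitarymx AC.
pose d i := complex.Re (sp 0 i).
have ed : sp = \row_i (d i)%:C%C.
  apply/rowP => i; rewrite mxE /d.
  have /mxOverP/(_ 0 i) := hermitian_spectral_diag_real hA.
  by case/complex_realP => k; rewrite -/sp => ->.
exists P, d; split=> //; first by rewrite -ed -invmx_unitary.
apply: eigenvalues_perm; apply: (map_poly_inj (real_complex R)).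
rewrite map_char_poly -/AC rmorph_prod.
rewrite (@char_poly_similar _ _ P _ (diag_mx sp)) ?unitarymx_unit //; last first.
  by rewrite [in LHS]eA !mulmxA mulmxV ?mul1mx // unitarymx_unit.
rewrite char_poly_trig ?diag_mx_is_trig // big_map enumT.
by apply: eq_bigr => i _; rewrite mxE eqxx mulr1n ed mxE rmorphB /= map_polyX map_polyC.
Qed.

End Eigenvalues.

Section HermitianForms.
Local Open Scope sesquilinear_scope.
Variable R : rcfType.
Implicit Types z : R[i].

Definition sqmod z : R := complex.Re z ^+ 2 + complex.Im z ^+ 2.

Lemma sqmodE z : z * Num.conj z = (sqmod z)%:C%C.
Proof.
rewrite -normCK normc_def -rmorphXn /= sqr_sqrtr //.
by rewrite addr_ge0 // sqr_ge0.
Qed.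

Lemma sqmod_ge0 z : 0 <= sqmod z.
Proof. by rewrite addr_ge0 // sqr_ge0. Qed.

Lemma sqmod_gt0 z : z != 0 -> 0 < sqmod z.
Proof.
move=> z0; rewrite lt0r sqmod_ge0 andbT; apply: contra z0.
by case: z => a b; rewrite /sqmod paddr_eq0 ?sqr_ge0 // !sqrf_eq0 eq_complex.
Qed.

Lemma sqmodN z : sqmod (- z) = sqmod z.
Proof. by case: z => a b; rewrite /sqmod /= !sqrrN. Qed.

Lemma sqmod_real (x : R) : sqmod x%:C%C = x ^+ 2.
Proof. by rewrite /sqmod /= expr0n addr0. Qed.

Lemma mul_trmxC_sqmod n (y : 'rV[R[i]]_n) :
  (y *m y ^t*) 0 0 = (\sum_i sqmod (y 0 i))%:C%C.
Proof.
rewrite mxE rmorph_sum; apply: eq_bigr => i _.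
by rewrite !mxE sqmodE.
Qed.

(** [d] lists the eigenvalues in an arbitrary order; [Is] is the permutation that sorts them, and
    [i0], [i1] are the indices holding the sorted positions 0 and 1. Working with positions rather
    than values covers multiple eigenvalues. *)
Lemma second_eigenvalue_basis n (A : 'M[R]_n) : A^T = A -> (1 < n)%N ->
  let lam := nth 0 (eigenvalues A) 1 in
  exists (P : 'M[R[i]]_n) (d : 'I_n -> R) (i0 i1 : 'I_n),
    [/\ P *m P ^t* = 1%:M,
        forall z : 'rV_n,
          (z *m P *m map_mx (real_complex R) A *m (z *m P) ^t*) 0 0 =
          (\sum_i d i * sqmod (z 0 i))%:C%C,
        i0 != i1, d i0 <= lam /\ d i1 <= lam &
        forall i, i != i0 -> lam <= d i].
Proof.
move=> sA n1 /=; have [P [d [/unitarymxP uP eA peig]]] := symmetric_spectral sA.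
set eig := eigenvalues A in peig *.
have seig : size eig = n by rewrite (perm_size peig) size_codom card_ord.
move: peig; rewrite perm_sym => /(perm_iotaP 0)[Is pIs eIs].
have sIs : size Is = n by rewrite (perm_size pIs) size_iota.
have uIs : uniq Is by rewrite (perm_uniq pIs) iota_uniq.
have memIs k : (k \in Is) = (k < n)%N.
  by rewrite (perm_mem pIs) mem_iota seig.
have dE i : d i = nth 0 eig (nth 0%N Is i).
  have : nth 0 (codom d) i = d i.
    by rewrite /codom (nth_map i) ?size_enum_ord // nth_ord_enum.
  by rewrite eIs (nth_map 0%N) ?sIs // => ->.
have lt_idx k : (k < n)%N -> (index k Is < n)%N by rewrite -{2}sIs index_mem memIs.
have n0 : (0 < n)%N := ltnW n1.
have nondec := sorted_leq_nth le_trans (@lexx _ R) 0 (eigenvalues_sorted A).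
rewrite -/eig in nondec.
pose i0 := Ordinal (lt_idx _ n0); pose i1 := Ordinal (lt_idx _ n1).
have di0 : d i0 = nth 0 eig 0 by rewrite dE nth_index // memIs.
have di1 : d i1 = nth 0 eig 1 by rewrite dE nth_index // memIs.
exists P, d, i0, i1; split=> //.
- move=> z; rewrite eA trmx_mul map_mxM /= !mulmxA.
  rewrite -(mulmxA z) uP mulmx1 -[X in X *m z ^t*]mulmxA uP mulmx1.
  rewrite mul_mx_diag !mxE rmorph_sum; apply: eq_bigr => i _.
  by rewrite !mxE rmorphM /= -sqmodE mulrAC mulrC.
- apply/eqP => /(congr1 val)/= e01.
  have := nth_index 0%N (s := Is) (x := 1%N).
  by rewrite -e01 nth_index ?memIs // => /(_ n1).
- by rewrite di0 di1 nondec ?inE ?seig.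
move=> i ii0; rewrite dE; apply: nondec; rewrite ?inE ?seig //.
  by rewrite -memIs mem_nth // sIs.
rewrite lt0n; apply: contra ii0 => /eqP e0; apply/eqP/val_inj => /=.
by rewrite -e0 index_uniq // sIs.
Qed.

End HermitianForms.

(** * The variational characterization of [mu] *)

Section Variational.
Local Open Scope sesquilinear_scope.
Variable R : rcfType.

(** For [adj] this is the Laplacian quadratic form: the factor 1/2 undoes the count of each edge as
    two ordered pairs. *)
Definition energy (T : finType) (e : rel T) (f : T -> R) : R :=
  2^-1 * \sum_u \sum_v (e u v)%:R * (f u - f v) ^+ 2.

Lemma energy_ge0 (T : finType) (e : rel T) f : 0 <= energy e f.
Proof.
rewrite mulr_ge0 ?invr_ge0 ?ler0n //; apply: sumr_ge0 => u _.
by apply: sumr_ge0 => v _; rewrite mulr_ge0 ?sqr_ge0 ?ler0n.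
Qed.

Variable G : sgraph.
Let n := #|G|.
Let L := laplacian R G.

Lemma laplacianE i j : L i j =
  (degree (enum_val i))%:R *+ (i == j) - (adj (enum_val i) (enum_val j))%:R.
Proof. by rewrite !mxE. Qed.

Lemma laplacian_sym : L^T = L.
Proof.
apply/matrixP => i j; rewrite mxE !laplacianE adj_sym eq_sym.
by case: eqVneq => [->|].
Qed.

Lemma degreeE (x : G) : (degree x)%:R = \sum_y (adj x y)%:R :> R.
Proof.
rewrite -natr_sum /degree -sum1_card big_mkcond.
by congr (_%:R); apply: eq_bigr => y _; rewrite inE; case: adj.
Qed.

Lemma laplacian_form (y : G -> R[i]) :
  let r : 'rV_n := \row_i y (enum_val i) in
  (r *m map_mx (real_complex R) L *m r ^t*) 0 0 =
  (2^-1 * \sum_u \sum_v (adj u v)%:R * sqmod (y u - y v))%:C%C.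
Proof.
move=> r; pose a (u v : G) : R[i] := (adj u v)%:R.
have aC u v : a u v = a v u by rewrite /a adj_sym.
have -> : (r *m map_mx (real_complex R) L *m r ^t*) 0 0 =
    \sum_u \sum_v (a u v * (y u * (y u)^* ) - a u v * (y u * (y v)^* )).
  rewrite mxE.
  under eq_bigr => j _ do rewrite mxE big_distrl /=.
  rewrite exchange_big /= [RHS](reindex _ (onW_bij _ (@enum_val_bij G))) /=.
  apply: eq_bigr => i _.
  rewrite sumrB -mulr_suml.
  transitivity (\sum_(j < n) ((degree (enum_val i))%:R *+ (i == j) *
     (y (enum_val i) * (y (enum_val j))^* ) -
     a (enum_val i) (enum_val j) * (y (enum_val i) * (y (enum_val j))^* ))).
    apply: eq_bigr => j _.
    rewrite [map_mx _ L _ _]mxE laplacianE !mxE rmorphB rmorphMn /= !rmorph_nat.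
    by rewrite /a; ring.
  rewrite sumrB; congr (_ - _).
    rewrite (bigD1 i) //= eqxx mulr1n big1 ?addr0 => [|j]; last first.
      by rewrite eq_sym => /negbTE ->; rewrite mulr0n mul0r.
    congr (_ * _); have /(congr1 (real_complex R)) := degreeE (enum_val i).
    rewrite rmorph_nat => ->; rewrite rmorph_sum; apply: eq_bigr => v _.
    by rewrite rmorph_nat.
  by rewrite [RHS](reindex _ (onW_bij _ (@enum_val_bij G))).
under eq_bigr => u _ do rewrite sumrB.
rewrite sumrB.
set S1 := \sum_u \sum_v _; set S2 := \sum_u \sum_v _.
(* Twice the form is the form plus its copy with [u] and [v] exchanged; the four terms then group
   into |y u - y v|^2. *)
have S1' : S1 = \sum_u \sum_v a u v * (y v * (y v)^* ).
  by rewrite /S1 exchange_big; apply: eq_bigr => u _; apply: eq_bigr => v _; rewrite aC.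
have S2' : S2 = \sum_u \sum_v a u v * (y v * (y u)^* ).
  by rewrite /S2 exchange_big; apply: eq_bigr => u _; apply: eq_bigr => v _; rewrite aC.
have two0 : (2 : R[i]) != 0 by rewrite pnatr_eq0.
have half : (2 : R[i]) * (2^-1 : R)%:C%C = 1.
  by rewrite -(rmorph_nat (real_complex R)) -rmorphM mulfV ?rmorph1 ?pnatr_eq0.
apply: (mulfI two0); rewrite rmorphM /= [RHS]mulrA half mul1r.
rewrite mulr_natl mulr2n {1}S1' {2}S2' -/S1 -/S2.
rewrite rmorph_sum.
transitivity (\sum_u \sum_v (a u v * (y v * (y v)^* ) - a u v * (y u * (y v)^* )
   + (a u v * (y u * (y u)^* ) - a u v * (y v * (y u)^* )))).
  rewrite -!sumrB -!big_split; apply: eq_bigr => u _ /=.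
  by rewrite -!sumrB -!big_split.
apply: eq_bigr => u _; rewrite rmorph_sum; apply: eq_bigr => v _.
by rewrite rmorphM rmorph_nat /= -sqmodE rmorphB /a /=; ring.
Qed.

Lemma laplacian_basis : (1 < n)%N ->
  exists (P : 'M[R[i]]_n) (d : 'I_n -> R) (i0 i1 : 'I_n),
    [/\ forall y : G -> R[i],
          let z : 'rV_n := \row_i y (enum_val i) *m P ^t* in
          2^-1 * \sum_u \sum_v (adj u v)%:R * sqmod (y u - y v) =
            \sum_i d i * sqmod (z 0 i) /\
          \sum_i sqmod (z 0 i) = \sum_u sqmod (y u),
        P *m P ^t* = 1%:M,
        i0 != i1, d i0 <= mu R G /\ d i1 <= mu R G &
        forall i, i != i0 -> mu R G <= d i].
Proof.
move=> n1; have [P [d [i0 [i1 [uP formP i01 dle dge]]]]] :=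
  second_eigenvalue_basis laplacian_sym n1.
have uP' : P ^t* *m P = 1%:M := mulmx1C uP.
exists P, d, i0, i1; split=> // y; set r : 'rV_n := \row_i _ => z.
have zP : z *m P = r by rewrite /z -mulmxA uP' mulmx1.
split; apply: (fmorph_inj (real_complex R)).
  by apply: etrans (formP z); rewrite zP laplacian_form.
apply: etrans (esym (mul_trmxC_sqmod z)) _; rewrite /z trmx_mul map_mxM /= mulmxA -(mulmxA r).
have -> : P ^t* *m (P ^t*)^t* = 1%:M by rewrite trmxCK.
rewrite mulmx1 mul_trmxC_sqmod; congr (real_complex R _).
rewrite [RHS](reindex _ (onW_bij _ (@enum_val_bij G))) /=.
by apply: eq_bigr => i _; rewrite mxE.
Qed.

(** The eigenvector of index [i0] is not known to be constant. Adding a constant [c] to [f] can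
    still cancel the coordinate [i0]; this leaves the energy unchanged and, [f] having zero sum,
    cannot decrease the sum of squares. *)
Lemma mu_le_energy (f : G -> R) : (1 < n)%N -> \sum_u f u = 0 ->
  mu R G * \sum_u f u ^+ 2 <= energy adj f.
Proof.
move=> n1 f0; have [mu_le0|mu_gt0] := lerP (mu R G) 0.
  apply: le_trans (energy_ge0 _ _); rewrite mulr_le0_ge0 //.
  by apply: sumr_ge0 => u _; exact: sqr_ge0.
have [P [d [i0 [i1 [key _ _ _ dge]]]]] := laplacian_basis n1.
have ge (z : 'rV[R[i]]_n) : z 0 i0 = 0 ->
    mu R G * \sum_i sqmod (z 0 i) <= \sum_i d i * sqmod (z 0 i).
  move=> z0; rewrite mulr_sumr; apply: ler_sum => i _.
  have [->|/dge mud] := eqVneq i i0; last by rewrite ler_wpM2r ?sqmod_ge0.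
  by rewrite z0 /sqmod /= expr0n addr0 !mulr0.
have [key11 key12] := key (fun=> 1); set z1 := _ *m _ in key11 key12.
(* If the constant function had no component along [i0], then [ge] would bound mu * n by the energy
   of a constant, which is 0. *)
have [z10|z1N0] := eqVneq (z1 0 i0) 0.
  have := ge _ z10; rewrite key12 -key11.
  rewrite [X in _ <= X](_ : _ = 0); last first.
    rewrite big1 ?mulr0 // => u _; rewrite big1 // => v _.
    by rewrite subrr /sqmod /= expr0n addr0 mulr0.
  rewrite pmulr_rle0 // leNgt => /negP[].
  rewrite (eq_bigr (fun=> 1)) => [|u _]; last first.
    by rewrite /sqmod /= expr1n expr0n addr0.
  by rewrite sumr_const ltr0n (ltnW n1).
pose x : 'rV[R[i]]_n := \row_i (f (enum_val i))%:C%C *m P ^t*.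
pose c := - (x 0 i0 / z1 0 i0).
have [keyf1 keyf2] := key (fun u => (f u)%:C%C + c); set z := _ *m _ in keyf1 keyf2.
have zE : z = x + c *: z1.
  rewrite /z /x /z1 scalemxAl -mulmxDl; congr (_ *m _).
  by apply/rowP => i; rewrite !mxE mulr1.
have z0 : z 0 i0 = 0 by rewrite zE mxE [X in _ + X]mxE mulNr divfK ?subrr.
have := ge _ z0; rewrite keyf2 -keyf1.
have -> : 2^-1 * (\sum_u \sum_v (adj u v)%:R *
    sqmod ((f u)%:C%C + c - ((f v)%:C%C + c))) = energy adj f.
  congr (_ * _); apply: eq_bigr => u _; apply: eq_bigr => v _.
  by rewrite opprD addrACA subrr addr0 -rmorphB sqmod_real.
apply: le_trans; rewrite ler_wpM2l ?(ltW mu_gt0) //.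
have -> : \sum_u sqmod ((f u)%:C%C + c) =
    \sum_u f u ^+ 2 + (2 * complex.Re c * \sum_u f u + \sum_(u : G) sqmod c).
  rewrite mulr_sumr -!big_split /=; apply: eq_bigr => u _.
  by case: (c) => a b; rewrite /sqmod /=; ring.
rewrite f0 mulr0 add0r lerDl; apply: sumr_ge0 => u _; exact: sqmod_ge0.
Qed.

(** The span of the eigenvectors [i0] and [i1] has dimension two, so it contains a nonzero [y] of
    zero sum, whose energy is at most [mu] times its square norm. The hypothesis is applied to its
    real and imaginary parts separately. *)
Lemma le_mu (lam : R) : (1 < n)%N ->
  (forall f : G -> R, \sum_u f u = 0 ->
     lam * \sum_u f u ^+ 2 <= energy adj f) ->
  lam <= mu R G.
Proof.
move=> n1 hlam; have [P [d [i0 [i1 [key uP i01 [d0 d1] _]]]]] := laplacian_basis n1.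
pose s i : R[i] := \sum_j P i j.
have [a [b [ab0 abs]]] : exists a b : R[i],
    0 < sqmod a + sqmod b /\ a * s i0 + b * s i1 = 0.
  have [s0|s0] := eqVneq (s i0) 0.
    exists 1, 0; rewrite s0 mulr0 mul0r addr0; split=> //.
    by rewrite ltr_pwDl ?sqmod_ge0 ?sqmod_gt0 ?oner_eq0.
  exists (s i1), (- s i0); split; last by rewrite mulNr mulrC subrr.
  by rewrite sqmodN ltr_wpDl ?sqmod_ge0 ?sqmod_gt0.
pose w : 'rV[R[i]]_n := a *: delta_mx 0 i0 + b *: delta_mx 0 i1.
pose y u : R[i] := (w *m P) 0 (enum_rank u).
have yr : \row_i y (enum_val i) = w *m P.
  by apply/rowP => i; rewrite mxE /y enum_valK.
have [] := key y; rewrite yr -mulmxA uP mulmx1 => k1 k2.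
have w0 : w 0 i0 = a.
  by rewrite !mxE !eqxx (negbTE i01) mulr1 mulr0 addr0.
have w1 : w 0 i1 = b.
  by rewrite !mxE !eqxx eq_sym (negbTE i01) mulr1 mulr0 add0r.
have sumw (F : 'I_n -> R) : \sum_i F i * sqmod (w 0 i) =
    F i0 * sqmod a + F i1 * sqmod b.
  rewrite (bigD1 i0) //= (bigD1 i1) 1?eq_sym //= w0 w1 big1 ?addr0 // => i.
  case/andP=> ii0 ii1; rewrite !mxE /= (negbTE ii0) (negbTE ii1) !mulr0 addr0.
  by rewrite /sqmod /= expr0n addr0 mulr0.
have y0 : \sum_u y u = 0.
  rewrite (reindex _ (onW_bij _ (@enum_val_bij G))) /= -[RHS]abs /s !mulr_sumr.
  rewrite -big_split; apply: eq_bigr => i _ /=.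
  by rewrite /y enum_valK /w mulmxDl -!scalemxAl -!rowE !mxE.
have y0' : (\sum_u complex.Re (y u))%:C%C + 'i%C * (\sum_u complex.Im (y u))%:C%C = 0.
  rewrite -[RHS]y0 !rmorph_sum mulr_sumr -big_split; apply: eq_bigr => u _ /=.
  by rewrite -complexE.
have [re0 im0] : \sum_u complex.Re (y u) = 0 /\ \sum_u complex.Im (y u) = 0.
  by move/eqP: y0'; rewrite eq_complex /= => /andP[/eqP + /eqP]; lra.
have := lerD (hlam _ re0) (hlam _ im0).
have -> : energy adj (fun u => complex.Re (y u)) + energy adj (fun u => complex.Im (y u)) =
    d i0 * sqmod a + d i1 * sqmod b.
  rewrite -sumw -k1 /energy -mulrDr -big_split; congr (_ * _).
  apply: eq_bigr => u _; rewrite -big_split; apply: eq_bigr => v _ /=.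
  by rewrite -mulrDr; case: (y u) (y v) => ? ? [].
rewrite -mulrDr -big_split /= => le1.
have sumq : sqmod a + sqmod b = \sum_u sqmod (y u).
  by rewrite -k2 -[LHS](mul1r) mulrDr -(sumw (fun=> 1)); apply: eq_bigr => i _; rewrite mul1r.
have le2 : lam * (sqmod a + sqmod b) <= mu R G * (sqmod a + sqmod b).
  rewrite {1}sumq; apply: le_trans le1 _.
  by rewrite [X in _ <= X]mulrDr lerD // ler_wpM2r ?sqmod_ge0.
by rewrite ler_pM2r in le2.
Qed.
End Variational.

(** * Sums over concatenated paths *)

Section Sums.
Variable R : realFieldType.

Lemma sum_triple m (F : nat -> R) :
  \sum_(j < 3 * m) F j =
  \sum_(k < m) (F (3 * k)%N + F (3 * k).+1 + F (3 * k).+2).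
Proof.
elim: m => [|m IH]; first by rewrite muln0 !big_ord0.
rewrite mulnSr addn3 !big_ord_recr IH /= -!addrA.
by congr (_ + _).
Qed.

Lemma sum_kronecker M q (F : nat -> R) :
  \sum_(j < M) ((j == q :> nat)%:R * F j) = (q < M)%:R * F q.
Proof.
have [qM|Mq] := ltnP q M.
  rewrite (bigD1 (Ordinal qM)) //= eqxx mul1r big1 ?addr0 ?mul1r // => j jq.
  by rewrite (_ : (j == q :> nat) = false) ?mul0r //; apply/negbTE.
rewrite mul0r big1 // => j _; rewrite (_ : (j == q :> nat) = false) ?mul0r //.
by apply/negbTE; rewrite neq_ltn (leq_trans (ltn_ord j) Mq).
Qed.

Lemma sum_consecutive M (F : nat -> nat -> R) : (forall i j, F i j = F j i) ->
  \sum_(j < M) \sum_(k < M)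
    ((k == j.+1 :> nat)%:R * F j k + (j == k.+1 :> nat)%:R * F j k) =
  2 * \sum_(j < M.-1) F j j.+1.
Proof.
move=> FC.
have up (F' : nat -> nat -> R) :
    \sum_(j < M) \sum_(k < M) (k == j.+1 :> nat)%:R * F' j k =
    \sum_(j < M.-1) F' j j.+1.
  under eq_bigr => j _ do rewrite (sum_kronecker M j.+1 (F' j)).
  case: M => [|M]; first by rewrite !big_ord0.
  rewrite big_ord_recr /= ltnn mul0r addr0.
  by apply: eq_bigr => j _; rewrite ltnS ltn_ord mul1r.
under eq_bigr => j _ do rewrite big_split.
rewrite big_split up exchange_big /=.
under [X in _ + X]eq_bigr => j _ do under eq_bigr => k _ do rewrite FC.
by rewrite up mulr_natl mulr2n.
Qed.

Section Offsets.
Variable l : nat -> nat.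
Definition offset s := (\sum_(k < s) l k)%N.

Lemma offsetS s : offset s.+1 = (offset s + l s)%N.
Proof. by rewrite /offset big_ord_recr. Qed.

Lemma leq_offset i j : (i <= j)%N -> (offset i <= offset j)%N.
Proof.
move=> /subnKC <-; elim: (j - i)%N => [|k IH]; first by rewrite addn0.
by rewrite addnS offsetS (leq_trans IH) // leq_addr.
Qed.

Lemma sum_offset s (F : nat -> R) :
  \sum_(p < offset s) F p = \sum_(i < s) \sum_(k < l i) F (offset i + k)%N.
Proof.
elim: s => [|s IH]; first by rewrite /offset !big_ord0.
by rewrite offsetS big_split_ord /= IH big_ord_recr.
Qed.

(* The sequences [f i] on [0, l i], glued one after the other up to additive
   constants: clamping makes the i-th summand constant outside its own range. *)
Definition concat t (f : nat -> nat -> R) p :=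
  \sum_(i < t) f i (minn (p - offset i) (l i)).

Lemma concat_step t f i k : (i < t)%N -> (k < l i)%N ->
  concat t f (offset i + k).+1 - concat t f (offset i + k) = f i k.+1 - f i k.
Proof.
move=> it kl; rewrite /concat -sumrB (bigD1 (Ordinal it)) //= big1 => [|j ji].
  rewrite addr0 -addnS !addKn.
  by have -> : minn k.+1 (l i) = k.+1 by [lia]; have -> : minn k (l i) = k by [lia].
have {ji} : (j != i :> nat) by [].
rewrite neq_ltn => /orP[/leq_offset|/leq_offset]; rewrite offsetS => ji.
  rewrite [X in f j X](_ : _ = l j); last by lia.
  by rewrite [X in _ - f j X](_ : _ = l j) ?subrr //; lia.
rewrite [X in f j X](_ : _ = 0)%N; last by lia.
by rewrite [X in _ - f j X](_ : _ = 0)%N ?subrr //; lia.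
Qed.

Lemma concat_shift t f i k : (i < t)%N -> (k <= l i)%N ->
  f i k - concat t f (offset i + k) = f i 0%N - concat t f (offset i).
Proof.
move=> it; elim: k => [|k IH] kl; first by rewrite addn0.
rewrite -(IH (ltnW kl)) addnS; have := concat_step f it kl; lra.
Qed.

End Offsets.

(** The average of [f x - g y] over all pairs is the difference [D] of the two means, and the sum of
    squared deviations from [D] is nonnegative. On a complete bipartite graph, averaging over both
    sides thus never raises the energy. *)
Lemma sum_sqr_bipartite (p q : nat) (f : 'I_p -> R) (g : 'I_q -> R) :
  (0 < p)%N -> (0 < q)%N ->
  p%:R * q%:R * ((\sum_x f x) / p%:R - (\sum_y g y) / q%:R) ^+ 2
  <= \sum_x \sum_y (f x - g y) ^+ 2.
Proof.
move=> p0 q0; have P0 : 0 < p%:R :> R by rewrite ltr0n.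
have Q0 : 0 < q%:R :> R by rewrite ltr0n.
set F := \sum_x f x; set H := \sum_y g y.
pose D := F / p%:R - H / q%:R.
have : 0 <= \sum_x \sum_y ((f x - g y) - D) ^+ 2.
  by apply: sumr_ge0 => x _; apply: sumr_ge0 => y _; exact: sqr_ge0.
have -> : \sum_x \sum_y ((f x - g y) - D) ^+ 2 =
    \sum_x \sum_y (f x - g y) ^+ 2 - 2 * D * \sum_x \sum_y (f x - g y)
      + p%:R * q%:R * D ^+ 2.
  rewrite mulr_sumr -sumrB.
  have -> : p%:R * q%:R * D ^+ 2 = \sum_(x < p) \sum_(y < q) D ^+ 2.
    rewrite !sumr_const !card_ord -[RHS]mulr_natr -[X in _ = X * _]mulr_natr.
    by ring.
  rewrite -big_split; apply: eq_bigr => x _ /=.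
  rewrite mulr_sumr -sumrB -big_split; apply: eq_bigr => y _ /=; ring.
have -> : \sum_x \sum_y (f x - g y) = p%:R * q%:R * D.
  under eq_bigr => x _ do rewrite sumrB sumr_const card_ord -/H.
  rewrite sumrB sumrMnl sumr_const card_ord -/F.
  rewrite -[F *+ q]mulr_natr -[H *+ p]mulr_natr /D.
  by field; rewrite !gt_eqF.
by rewrite -/D; set S := \sum_x _; lra.
Qed.

Lemma mean_dist (p : nat) (g : 'I_p -> R) (y s : R) : (0 < p)%N ->
  (forall x, `|y - g x| <= s) -> `|y - (\sum_x g x) / p%:R| <= s.
Proof.
move=> p0 gs; have P0 : 0 < p%:R :> R by rewrite ltr0n.
have -> : y - (\sum_x g x) / p%:R = (\sum_x (y - g x)) / p%:R.
  rewrite sumrB sumr_const card_ord mulrBl -[y *+ p]mulr_natr mulfK //.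
  by rewrite gt_eqF.
rewrite normrM normfV (gtr0_norm P0) ler_pdivrMr //.
apply: le_trans (ler_norm_sum _ _ _) _.
rewrite mulr_natr -[X in _ *+ X]card_ord -sumr_const.
by apply: ler_sum => x _.
Qed.

(* Conductances [ab], [bc], [ca] in series have resistance
   [(a + b + c) / (abc)]. *)
Lemma series_resistance (a b c x0 x1 x2 x3 : R) : 0 < a -> 0 < b -> 0 < c ->
  a * b * c / (a + b + c) * (x3 - x0) ^+ 2 <=
  a * b * (x1 - x0) ^+ 2 + b * c * (x2 - x1) ^+ 2 + c * a * (x3 - x2) ^+ 2.
Proof.
move=> a0 b0 c0; have s0 : 0 < a + b + c by rewrite !addr_gt0.
rewrite mulrAC ler_pdivrMr // -subr_ge0.
set u := x1 - x0; set v := x2 - x1; set w := x3 - x2.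
have -> : x3 - x0 = u + v + w by rewrite /u /v /w; ring.
(* Lagrange's identity: the defect in Cauchy-Schwarz as a sum of squares. *)
rewrite (_ : _ - _ = b * (a * u - c * v) ^+ 2 + a * (b * u - c * w) ^+ 2
                   + c * (b * v - a * w) ^+ 2); last by ring.
by rewrite !addr_ge0 // mulr_ge0 ?sqr_ge0 ?ltW.
Qed.

Lemma connect_homo (T T' : finType) (r : rel T) (r' : rel T') (h : T -> T') :
  (forall x y, r x y -> r' (h x) (h y)) ->
  forall x y, connect r x y -> connect r' (h x) (h y).
Proof.
move=> rr' x y /connectP[p + ->].
elim: p x => [|z p IH] x /=; first by move=> _; exact: connect0.
by case/andP=> /rr' rxz /IH; apply: connect_trans; exact: connect1.
Qed.

(** A path can be made simple, hence takes fewer than #|T| steps. *)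
Lemma card_path_bound (T : finType) (e : rel T) (h : T -> R) (s : R) :
  0 <= s -> (forall x y, e x y -> `|h x - h y| <= s) ->
  forall x y, connect e x y -> `|h x - h y| <= #|T|%:R * s.
Proof.
move=> s0 es x y /connectP[p pe ->].
have [p' pe' up' _] := shortenP pe.
have : `|h x - h (last x p')| <= (size p')%:R * s.
  elim: p' x pe' {up' pe} => [|z q IH] x /=; first by rewrite subrr normr0 mul0r.
  move=> /andP[/es xz /IH zq]; rewrite -natr1 mulrDl mul1r [X in _ <= X]addrC.
  by apply: le_trans (ler_distD (h z) _ _) _; exact: lerD.
move=> /le_trans; apply; rewrite ler_wpM2r // ler_nat.
by apply: leq_trans (max_card (mem (x :: p'))); rewrite (card_uniqP up') /= leqnSn.
Qed.

End Sums.

(** * Energies on a graph of the family *)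

Section BaseGraph.
Variables (R : rcfType) (t : nat) (m a b c : 'I_t -> nat) (H : 'I_t.+1 -> sgraph).
Variable d C : nat.
Hypothesis t_gt0 : (0 < t)%N.
Hypothesis t_le : (t <= C)%N.
Hypothesis abc_gt0 : forall i, [/\ 0 < m i, 0 < a i, 0 < b i & 0 < c i]%N.
Hypothesis abc_sum : forall i, (a i + b i + c i = d.+1)%N.
Hypothesis H_le : (\sum_i #|H i| <= C)%N.

Local Notation V := (base_graph m a b c H).
Variable e : rel V.
Hypothesis e_sym : symmetric e.
Hypothesis adj_e : forall u v : V, adj u v -> e u v.
Hypothesis e_adj : forall u v : V, e u v -> adj u v || may_add u v.
Hypothesis e_conn : forall u v, connect e u v.

(** The same expression as in [Gabc], so that the cells are convertible to cliques on
    ['I_(width i j)]. *)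
Definition width (i : 'I_t) (j : nat) : nat := nth 0%N [:: a i; b i; c i] (j %% 3).

Definition minor_vertex (k : 'I_t.+1) (h : H k) : V :=
  inl (Tagged (fun k => vertex (H k)) h).

Definition cell_vertex (i : 'I_t) (j : 'I_(3 * m i)) (x : 'I_(width i j)) : V :=
  inr (Tagged (fun i => vertex (Gabc (a i) (b i) (c i) (m i)))
    (Tagged (fun j : 'I_(3 * m i) => vertex (clique (width i j))) x)).
Arguments cell_vertex : clear implicits.

Variant vertex_spec : V -> Type :=
  | MinorVertex k (h : H k) : vertex_spec (minor_vertex h)
  | CellVertex i j x : vertex_spec (cell_vertex i j x).

Lemma vertexP v : vertex_spec v.
Proof. by case: v => [[k h]|[i [j x]]]; [exact: MinorVertex | exact: CellVertex]. Qed.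

Lemma width_gt0 i j : (0 < width i j)%N.
Proof.
have [_ a0 b0 c0] := abc_gt0 i.
by rewrite /width; case: (j %% 3)%N (ltn_pmod j (isT : 0 < 3)%N) => [|[|[]]].
Qed.

Lemma sum_vertex (F : V -> R) :
  \sum_v F v = \sum_k \sum_h F (@minor_vertex k h)
    + \sum_i \sum_j \sum_x F (cell_vertex i j x).
Proof.
rewrite big_sumType /=; congr (_ + _).
  rewrite (sig_big_dep _ _ (fun k h => F (@minor_vertex k h))) /=.
  by apply: eq_bigr => -[k h] _.
under [RHS]eq_bigr => i _ do
  rewrite (sig_big_dep _ _ (fun j x => F (cell_vertex i j x))) /=.
rewrite (sig_big_dep _ _ (fun i (u : Gabc (a i) (b i) (c i) (m i)) =>
  F (cell_vertex i (tag u) (tagged u)))) /=.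
by apply: eq_bigr => -[i [j x]] _.
Qed.

Lemma cell_adjacent i j x j' x' :
  adj (cell_vertex i j x) (cell_vertex i j' x') =
  [|| adj (Tagged (fun j : 'I_(3 * m i) => vertex (clique (width i j))) x
          : disjoint_union (fun j : 'I_(3 * m i) => clique (width i j)))
        (Tagged (fun j : 'I_(3 * m i) => vertex (clique (width i j))) x'),
      j' == j.+1 :> nat | j == j'.+1 :> nat].
Proof. by rewrite /= /union_adj /= eqxx tagged_asE. Qed.

Lemma e_consecutive i (j j' : 'I_(3 * m i)) x x' :
  j' == j.+1 :> nat -> e (cell_vertex i j x) (cell_vertex i j' x').
Proof. by move=> jj'; apply: adj_e; rewrite cell_adjacent jj' orbT. Qed.

Lemma e_same_cell i (j : 'I_(3 * m i)) x x' :
  x != x' -> e (cell_vertex i j x) (cell_vertex i j x').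
Proof.
move=> xx'; apply: adj_e; rewrite cell_adjacent /= /union_adj /= eqxx.
by rewrite tagged_asE /= /clique_adj xx'.
Qed.

Lemma e_cell i j x i' j' x' : e (cell_vertex i j x) (cell_vertex i' j' x') ->
  i = i' /\ [|| j == j' :> nat, j' == j.+1 :> nat | j == j'.+1 :> nat].
Proof.
move=> /e_adj; rewrite orbF => h; have ii' : i = i'.
  by move: h => /= /andP[/eqP].
split=> //; subst i'; move: h; rewrite cell_adjacent => /or3P[|->|->]; rewrite ?orbT //.
by rewrite /= /union_adj => /andP[/eqP/(congr1 val)/eqP/= -> _].
Qed.

Lemma e_minor k (h : H k) k' (h' : H k') :
  e (minor_vertex h) (minor_vertex h') -> k = k'.
Proof. by move=> /e_adj; rewrite orbF /= => /andP[/eqP]. Qed.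

Lemma e_minor_cell k (h : H k) i j x : e (minor_vertex h) (cell_vertex i j x) ->
  ((k == i :> nat) && (j == 0 :> nat)) ||
  ((k == i.+1 :> nat) && (j.+1 == 3 * m i :> nat))%N.
Proof. by move=> /e_adj. Qed.

Lemma width0 i k : width i (3 * k) = a i.
Proof. by rewrite /width (_ : _ %% 3 = 0)%N //; lia. Qed.

Lemma width1 i k : width i (3 * k).+1 = b i.
Proof. by rewrite /width (_ : _ %% 3 = 1)%N //; lia. Qed.

Lemma width2 i k : width i (3 * k).+2 = c i.
Proof. by rewrite /width (_ : _ %% 3 = 2)%N //; lia. Qed.

(** A major subgraph with [m i] periods covers [m i - 1] edges of the path. Extended by 0 from [t]
    on because [offset] takes a sequence on [nat]. *)
Definition steps (k : nat) : nat := if insub k is Some i then (m i).-1 else 0%N.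

Lemma stepsE (i : 'I_t) : steps i = (m i).-1.
Proof. by rewrite /steps valK. Qed.

Lemma stepsS (i : 'I_t) : m i = (steps i).+1.
Proof. by have [m0 _ _ _] := abc_gt0 i; rewrite stepsE prednK. Qed.

Local Notation off := (offset steps).

(* Last period of [G_i], first period of [G_(i+1)] and [H_i] share one index. *)
Definition period (v : V) : nat :=
  match v with
  | inl u => off (tag u)
  | inr u => off (tag u) + tag (tagged u) %/ 3
  end%N.

(** The ranges [off i, off (i+1)) tile [0, off t) and hold all periods of each major subgraph but
    its last one, which sits at [off i.+1] and is counted by the second sum. *)
Lemma sum_period (F : nat -> R) :
  \sum_v F (period v) =
  d.+1%:R * (\sum_(p < off t) F p + \sum_(i < t) F (off i.+1))
    + \sum_k #|H k|%:R * F (off k).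
Proof.
rewrite sum_vertex addrC; congr (_ + _); last first.
  by apply: eq_bigr => k _ /=; rewrite sumr_const cardT -cardE mulr_natl.
rewrite sum_offset -big_split mulr_sumr; apply: eq_bigr => i _ /=.
transitivity (\sum_(j < 3 * m i) (width i j)%:R * F (off i + j %/ 3)%N).
  by apply: eq_bigr => j _; rewrite sumr_const card_ord mulr_natl.
rewrite (sum_triple _ (fun j => (width i j)%:R * F (off i + j %/ 3)%N)).
have -> : \sum_(k < steps i) F (off i + k)%N + F (off i.+1) =
    \sum_(k < m i) F (off i + k)%N by rewrite offsetS stepsS big_ord_recr.
rewrite mulr_sumr; apply: eq_bigr => k _.
rewrite width0 width1 width2 -(abc_sum i) !natrD.
have [-> -> ->] : [/\ 3 * k %/ 3 = k, (3 * k).+1 %/ 3 = k & (3 * k).+2 %/ 3 = k]%N.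
  by split; lia.
by ring.
Qed.

Lemma sum_period_ge (F : nat -> R) : (forall p, 0 <= F p) ->
  d.+1%:R * \sum_(p < (off t).+1) F p <= \sum_v F (period v).
Proof.
move=> F0; rewrite sum_period big_ord_recr /=.
have lt1 : (t.-1 < t)%N by rewrite prednK.
apply: ler_wpDr; first by apply: sumr_ge0 => k _; rewrite mulr_ge0 ?ler0n.
rewrite ler_wpM2l ?ler0n // lerD2l (bigD1 (Ordinal lt1)) //= prednK //.
by rewrite lerDl sumr_ge0.
Qed.

(** The constant bounds the surplus over one period per index: at most [C] last periods of [d.+1]
    vertices, and at most [C] vertices in the H_i. *)
Lemma sum_period_le (F : nat -> R) (B : R) :
  (forall p, 0 <= F p) -> (forall p, (p <= off t)%N -> F p <= B) ->
  \sum_v F (period v) <=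
  d.+1%:R * \sum_(p < (off t).+1) F p + (d.+2 * C)%:R * B.
Proof.
move=> F0 FB; rewrite sum_period [X in _ <= _ * X + _]big_ord_recr /=.
have B0 : 0 <= B := le_trans (F0 0%N) (FB 0%N isT).
have s1 : \sum_(i < t) F (off i.+1) <= C%:R * B.
  apply: (@le_trans _ _ (\sum_(i < t) B)).
    by apply: ler_sum => i _; apply/FB/leq_offset.
  by rewrite sumr_const card_ord -[B *+ t]mulr_natl ler_wpM2r // ler_nat.
have s2 : \sum_k #|H k|%:R * F (off k) <= C%:R * B.
  apply: (@le_trans _ _ (\sum_k #|H k|%:R * B)).
    by apply: ler_sum => k _; rewrite ler_wpM2l ?ler0n // FB // leq_offset // -ltnS.
  by rewrite -mulr_suml -natr_sum ler_wpM2r // ler_nat.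
move: s1 s2; set S1 := \sum_(i < t) _; set S2 := \sum_k _; set S := \sum_(p < _) _.
have FN := F0 (off t) => s1 s2.
have dS1 : d.+1%:R * S1 <= d.+1%:R * (C%:R * B) by rewrite ler_wpM2l ?ler0n.
have dF : 0 <= d.+1%:R * F (off t) by rewrite mulr_ge0 ?ler0n.
have -> : (d.+2 * C)%:R * B = d.+1%:R * (C%:R * B) + C%:R * B.
  by rewrite natrM -[d.+2%:R]natr1; ring.
by rewrite !mulrDr; lra.
Qed.

(** * Averaging a function over the cells and gluing the averages *)

Section LowerProfile.
Variable f : V -> R.

(** A sum with at most one term: [j] can then be any natural number, with value 0 outside the
    cells. *)
Definition cell_mean i (j : nat) : R :=
  \sum_(k : 'I_(3 * m i) | k == j :> nat)
    (\sum_(x : 'I_(width i k)) f (cell_vertex i k x)) / (width i k)%:R.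

Lemma cell_meanE i (j : 'I_(3 * m i)) :
  cell_mean i j = (\sum_(x : 'I_(width i j)) f (cell_vertex i j x)) / (width i j)%:R.
Proof. by rewrite /cell_mean (big_pred1 j). Qed.

Let T u v := (e u v)%:R * (f u - f v) ^+ 2.

Let T_ge0 u v : 0 <= T u v.
Proof. by rewrite mulr_ge0 ?ler0n ?sqr_ge0. Qed.

Lemma double_energy : 2 * energy e f = \sum_u \sum_v T u v.
Proof. by rewrite /energy mulrA mulfV ?mul1r ?pnatr_eq0. Qed.

(** Only edges between consecutive cells of one major subgraph are kept; such cells are completely
    joined, so [sum_sqr_bipartite] applies to each pair. *)
Lemma energy_ge_means :
  \sum_i \sum_(j < (3 * m i).-1) (width i j)%:R * (width i j.+1)%:R *
     (cell_mean i j.+1 - cell_mean i j) ^+ 2 <= energy e f.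
Proof.
have two0 : 0 < (2 : R) by rewrite ltr0n.
rewrite -(ler_pM2l two0) double_energy mulr_sumr sum_vertex.
rewrite -[X in X <= _]add0r lerD //.
  by apply: sumr_ge0 => k _; apply: sumr_ge0 => h _; apply: sumr_ge0 => v _.
apply: ler_sum => i _.
pose F j k := (width i j)%:R * (width i k)%:R * (cell_mean i k - cell_mean i j) ^+ 2.
have FC j k : F j k = F k j by rewrite /F; ring.
rewrite -(sum_consecutive _ FC); apply: ler_sum => j _.
apply: (@le_trans _ _ (\sum_x \sum_k \sum_y
    T (cell_vertex i j x) (cell_vertex i k y))); last first.
  apply: ler_sum => x _; rewrite sum_vertex -[X in X <= _]add0r lerD //.
    by apply: sumr_ge0 => k _; apply: sumr_ge0.
  rewrite (bigD1 i) //= lerDl; apply: sumr_ge0 => i' _.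
  by apply: sumr_ge0 => k _; apply: sumr_ge0.
rewrite exchange_big /=; apply: ler_sum => k _.
have FT : (forall x y, e (cell_vertex i j x) (cell_vertex i k y)) ->
    F j k <= \sum_x \sum_y T (cell_vertex i j x) (cell_vertex i k y).
  move=> ejk; rewrite /F -sqrrN opprB !cell_meanE.
  apply: le_trans (sum_sqr_bipartite _ _ (width_gt0 i j) (width_gt0 i k)) _.
  apply: ler_sum => x _; apply: ler_sum => y _; by rewrite /T ejk mul1r.
have [kj|_] := eqVneq (k : nat) j.+1.
  rewrite (_ : (j == k.+1 :> nat) = false) ?mul0r ?addr0 ?mul1r; last first.
    by rewrite kj; lia.
  by apply: FT => x y; apply: e_consecutive; rewrite kj.
have [jk|_] := eqVneq (j : nat) k.+1; rewrite ?mul0r ?add0r ?mul1r; last first.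
  by apply: sumr_ge0 => x _; apply: sumr_ge0.
by apply: FT => x y; rewrite e_sym; apply: e_consecutive; rewrite jk.
Qed.

Lemma energy_ge_periods (l0 : R) : 0 < l0 ->
  (forall i, l0 <= (a i * b i * c i)%:R) ->
  \sum_(i < t) \sum_(k < steps i) (cell_mean i (3 * k.+1) - cell_mean i (3 * k)) ^+ 2
  <= d.+1%:R / l0 * energy e f.
Proof.
move=> l00 l0abc; have d0 : 0 < (d.+1%:R : R) by rewrite ltr0n.
rewrite mulrAC ler_pdivlMr // mulrC -ler_pdivrMl // mulrA.
apply: le_trans energy_ge_means; rewrite mulr_sumr; apply: ler_sum => i _.
pose F j := (width i j)%:R * (width i j.+1)%:R *
  (cell_mean i j.+1 - cell_mean i j) ^+ 2.
have F0 j : 0 <= F j by rewrite mulr_ge0 ?sqr_ge0 // mulr_ge0 ?ler0n.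
(* Of the 3m - 1 consecutive pairs, 3(m - 1) lead from one first cell to the next; the two pairs
   inside the last period are discarded. *)
rewrite stepsS (_ : (3 * (steps i).+1).-1 = (3 * steps i).+2)%N; last by lia.
rewrite !(big_ord_recr _ (fun j => F j)) /= -addrA.
apply: (@le_trans _ _ (\sum_(j < 3 * steps i) F j)); last by rewrite lerDl addr_ge0.
rewrite (sum_triple _ F) mulr_sumr; apply: ler_sum => k _.
have [_ a0 b0 c0] := abc_gt0 i.
have w3 : width i (3 * k).+3 = a i by rewrite -(width0 i k.+1) mulnS.
have -> : (3 * k.+1)%N = (3 * k).+3 by lia.
rewrite /F w3 width0 width1 width2.
apply: le_trans (series_resistance _ _ _ _ _ _ _); rewrite ?ltr0n //.
rewrite -!natrD abc_sum -!natrM ler_wpM2r ?sqr_ge0 // mulrC.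
by rewrite ler_wpM2r ?invr_ge0 ?ler0n.
Qed.

Let heights i k : R := if insub i is Some i0 then cell_mean i0 (3 * k) else 0.

Definition profile : nat -> R := concat steps t heights.

Lemma profile_energy (l0 : R) : 0 < l0 ->
  (forall i, l0 <= (a i * b i * c i)%:R) ->
  \sum_(p < off t) (profile p.+1 - profile p) ^+ 2 <= d.+1%:R / l0 * energy e f.
Proof.
move=> l00 l0abc; apply: le_trans (energy_ge_periods l00 l0abc).
rewrite (sum_offset _ _ (fun p => (profile p.+1 - profile p) ^+ 2)) /=.
apply: ler_sum => i _; apply: ler_sum => k _.
by rewrite concat_step // /heights valK.
Qed.

Variable s : R.
Hypothesis s_ge0 : 0 <= s.
Hypothesis s_energy : energy e f <= s ^+ 2.

Lemma edge_diff u v : e u v -> `|f u - f v| <= s.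
Proof.
move=> euv; have [->|uv] := eqVneq u v; first by rewrite subrr normr0.
rewrite -ler_sqr ?nnegrE // real_normK ?num_real //.
apply: le_trans s_energy; have two0 : 0 < (2 : R) by rewrite ltr0n.
rewrite -(ler_pM2l two0) double_energy.
have row x y : T x y <= \sum_v T x v.
  by rewrite (bigD1 y) //= lerDl sumr_ge0.
rewrite (bigD1 u) //= [X in _ <= _ + X](bigD1 v) 1?eq_sym //= addrA.
apply: ler_wpDr; first by apply: sumr_ge0 => x _; apply: sumr_ge0.
apply: le_trans (lerD (row u v) (row v u)).
by rewrite /T (e_sym v) euv !mul1r -(sqrrN (f v - f u)) opprB mulr_natl mulr2n.
Qed.

Lemma cell_to_period_start i (j k : 'I_(3 * m i)) x y :
  k = (3 * (j %/ 3))%N :> nat ->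
  `|f (cell_vertex i j x) - f (cell_vertex i k y)| <= 2 * s.
Proof.
move=> kj; have s2 : s <= 2 * s by rewrite mulr_natl mulr2n lerDl.
have : (j = k :> nat \/ j = k.+1 :> nat \/ j = k.+2 :> nat)%N by lia.
case=> [jk|[jk|jk]].
- have jk' : j = k := val_inj jk; subst k.
  have [->|xy] := eqVneq x y; first by rewrite subrr normr0 mulr_ge0.
  by apply: le_trans s2; apply/edge_diff/e_same_cell.
- apply: le_trans s2; apply: edge_diff; rewrite e_sym; apply: e_consecutive.
  by rewrite jk.
have k1 : (k.+1 < 3 * m i)%N by apply: leq_trans (ltn_ord j); rewrite jk.
pose z := cell_vertex i (Ordinal k1) (Ordinal (width_gt0 i k.+1)).
apply: le_trans (ler_distD (f z) _ _) _; rewrite mulr_natl mulr2n lerD //.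
  by apply: edge_diff; rewrite e_sym; apply: e_consecutive; rewrite /= jk.
by apply: edge_diff; rewrite e_sym; apply: e_consecutive.
Qed.

Lemma cell_to_mean i (j : 'I_(3 * m i)) x :
  `|f (cell_vertex i j x) - cell_mean i (3 * (j %/ 3))| <= 2 * s.
Proof.
have k3 : (3 * (j %/ 3) < 3 * m i)%N by have := ltn_ord j; lia.
rewrite -[X in cell_mean _ X]/(nat_of_ord (Ordinal k3)) cell_meanE.
by apply: mean_dist (width_gt0 _ _) _ => y; exact: cell_to_period_start.
Qed.

(* Contracting each major subgraph to a point leaves at most [2 * C] points, which
   bounds the length of the paths along which [shift] is compared. *)
Let contract (v : V) : {k & vertex (H k)} + 'I_t :=
  match v with inl u => inl u | inr u => inr (tag u) end.

(** The constant by which [f] exceeds [profile] around a point of the contracted graph. One value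
    serves a whole major subgraph because [profile] has there the increments of the first-cell
    means. *)
Let shift (q : {k & vertex (H k)} + 'I_t) : R :=
  match q with
  | inl u => f (inl u) - profile (off (tag u))
  | inr i => heights i 0 - profile (off i)
  end.

Let shift_contract v : `|f v - profile (period v) - shift (contract v)| <= 2 * s.
Proof.
case: (vertexP v) => [k h|i j x] /=; first by rewrite subrr normr0 mulr_ge0.
have kl : (j %/ 3 <= steps i)%N by have := ltn_ord j; have := stepsS i; lia.
rewrite -(concat_shift heights (ltn_ord i) kl) -/profile.
rewrite opprB addrA subrK {1}/heights valK.
exact: cell_to_mean.
Qed.

(** An attached cell lies in the first or last period of its major subgraph, whose index is that of
    the neighbouring H_i, so the values of [profile] cancel. The edge costs [s] and [shift_contract]
    another 2s; inside a contracted major subgraph nothing changes. *)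
Let shift_edge u v : e u v -> `|shift (contract u) - shift (contract v)| <= 3 * s.
Proof.
have mixed k (h : H k) i j x : e (minor_vertex h) (cell_vertex i j x) ->
    `|shift (contract (minor_vertex h)) - shift (contract (cell_vertex i j x))| <= 3 * s.
  move=> ehc; have := shift_contract (cell_vertex i j x).
  have -> : period (cell_vertex i j x) = off k.
    rewrite /=; case/orP: (e_minor_cell ehc) => /andP[/eqP -> /eqP jm].
      by rewrite jm addn0.
    by rewrite offsetS; congr (_ + _)%N; have := stepsS i; lia.
  have := s_ge0; have := edge_diff ehc; rewrite /= !ler_norml => /andP[? ?] ? /andP[? ?].
  by apply/andP; split; lra.
case: (vertexP u) => [k h|i j x]; case: (vertexP v) => [k' h'|i' j' x'] euv.
- have kk' := e_minor euv; subst k'.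
  have := edge_diff euv; rewrite /= opprB addrA subrK => /le_trans; apply.
  by have := s_ge0; lra.
- exact: mixed.
- by rewrite distrC; apply: mixed; rewrite e_sym.
have [ii' _] := e_cell euv; subst i'.
by rewrite subrr normr0 mulr_ge0.
Qed.

(** At most [C] vertices of the H_i and [t <= C] contracted points give a path of at most 2C edges
    costing 3s each, plus 2s from [v] to its contracted value: hence 6C + 2. *)
Lemma profile_close : exists c0 : R, forall v,
  `|f v - profile (period v) - c0| <= (6 * C + 2)%:R * s.
Proof.
exists (shift (inr (Ordinal t_gt0))) => v.
have [_ a0 _ _] := abc_gt0 (Ordinal t_gt0).
have m0 : (0 < 3 * m (Ordinal t_gt0))%N by have := stepsS (Ordinal t_gt0); lia.
pose r := cell_vertex (Ordinal t_gt0) (Ordinal m0) (Ordinal (width_gt0 _ 0)).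
pose e' := [rel x y | `|shift x - shift y| <= 3 * s].
have conn : connect e' (contract v) (contract r).
  by apply: connect_homo (e_conn v r) => x y; exact: shift_edge.
have s3 : 0 <= 3 * s by rewrite mulr_ge0.
have := card_path_bound s3 (fun x y (h : e' x y) => h) conn.
rewrite card_sum card_tagged card_ord => bnd.
apply: le_trans (ler_distD (shift (contract v)) _ _) _.
rewrite natrD mulrDl addrC lerD ?shift_contract //.
apply: le_trans bnd _; rewrite mulrA -natrM ler_wpM2r // ler_nat.
rewrite sumnE big_map big_enum /=.
have HC : (\sum_(k in 'I_t.+1) #|H k| <= C)%N := H_le.
by move: t_le HC; set S := (\sum_(k in _) _)%N; lia.
Qed.

End LowerProfile.

(** * Test functions built from electrical potentials *)

Section TestFunction.
Variable g : nat -> R.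

(* Potential drop across the conductances [ab], [bc], [ca] in series, as a
   fraction of the drop over a whole period. *)
Definition drop_fraction i r : R :=
  nth 0 [:: 0; (c i)%:R / d.+1%:R; (c i + a i)%:R / d.+1%:R] r.

(** The [else] branch keeps the potential constant on the last period, so that the last cell carries
    the value [g (off i.+1)] taken on the next H. *)
Definition cell_potential (i : 'I_t) (j : nat) : R :=
  let p := (off i + j %/ 3)%N in
  g p + drop_fraction i (j %% 3) *
    (if (j %/ 3 < steps i)%N then g p.+1 - g p else 0).

Definition test_function (v : V) : R :=
  match v with
  | inl u => g (off (tag u))
  | inr u => cell_potential (tag u) (tag (tagged u))
  end.

Lemma drop_fraction_01 i r : (r < 3)%N -> 0 <= drop_fraction i r <= 1.
Proof.
have d0 : 0 < (d.+1%:R : R) by rewrite ltr0n.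
have sum := abc_sum i.
case: r => [|[|[|]]] //= _; rewrite ?lexx ?ler01 // divr_ge0 ?ler0n //=;
  by rewrite ler_pdivrMr // mul1r ler_nat; lia.
Qed.

Lemma test_function_close v :
  (test_function v - g (period v)) ^+ 2 <= (g (period v).+1 - g (period v)) ^+ 2.
Proof.
case: (vertexP v) => [k h|i j x] /=; first by rewrite subrr expr0n sqr_ge0.
rewrite /cell_potential; set p := (_ + _)%N; rewrite addrAC subrr add0r.
case: ifP => _; last by rewrite mulr0 expr0n sqr_ge0.
have /andP[r0 r1] := drop_fraction_01 i (ltn_pmod j (isT : 0 < 3)%N).
rewrite exprMn ler_piMl ?sqr_ge0 // expr_le1 //.
Qed.

(** Conductances ab, bc, ca have resistances proportional to c, a, b. With these drops a period has
    energy (ab c^2 + bc a^2 + ca b^2) D^2 = abc (a + b + c) D^2, the equality case of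
    [series_resistance]. *)
Lemma period_potential (i : 'I_t) k : (k < steps i)%N ->
  let D := (g (off i + k).+1 - g (off i + k)) / d.+1%:R in
  [/\ cell_potential i (3 * k).+1 - cell_potential i (3 * k) = (c i)%:R * D,
      cell_potential i (3 * k).+2 - cell_potential i (3 * k).+1 = (a i)%:R * D &
      cell_potential i (3 * k).+3 - cell_potential i (3 * k).+2 = (b i)%:R * D].
Proof.
move=> kl /=; have d0 : (d.+1%:R : R) != 0 by rewrite pnatr_eq0.
have [e0 e1 e2 e3] : [/\ 3 * k %/ 3 = k, (3 * k).+1 %/ 3 = k,
    (3 * k).+2 %/ 3 = k & (3 * k).+3 %/ 3 = k.+1]%N by split; lia.
have [r0 r1 r2 r3] : [/\ 3 * k %% 3 = 0, (3 * k).+1 %% 3 = 1,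
    (3 * k).+2 %% 3 = 2 & (3 * k).+3 %% 3 = 0]%N by split; lia.
have eb : (b i)%:R = d.+1%:R - (c i + a i)%:R :> R.
  by rewrite -(abc_sum i) !natrD; ring.
rewrite /cell_potential e0 e1 e2 e3 r0 r1 r2 r3 kl /drop_fraction /= !mul0r addnS.
rewrite eb natrD; clear eb; move: (d.+1%:R : R) d0 => D D0.
by split; field.
Qed.

(** Edges inside a cell, inside some H_i or across an attachment join equal values; only consecutive
    cells of the same major subgraph carry energy. *)
Lemma test_function_energy (L : R) :
  (forall i, (a i * b i * c i)%:R <= L) ->
  energy e test_function <=
  L / d.+1%:R * \sum_(p < off t) (g p.+1 - g p) ^+ 2.
Proof.
move=> abcL; have two0 : 0 < (2 : R) by rewrite ltr0n.
pose F (i : 'I_t) j k := (width i j)%:R * (width i k)%:R *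
  (cell_potential i k - cell_potential i j) ^+ 2.
have FC i j k : F i j k = F i k j by rewrite /F; ring.
(* The condition selects the pairs with at least one end in some H_i. *)
have flat u v : (if v is inl _ then true else if u is inl _ then true else false) ->
    e u v -> test_function u = test_function v.
  have mixed k (h : H k) i j x : e (minor_vertex h) (cell_vertex i j x) ->
      test_function (minor_vertex h) = test_function (cell_vertex i j x).
    move=> ehc /=; rewrite /cell_potential.
    case/orP: (e_minor_cell ehc) => /andP[/eqP -> /eqP jm].
      by rewrite jm /drop_fraction /= mul0r addr0 addn0.
    have -> : (j %/ 3 = steps i)%N by have := stepsS i; lia.
    by rewrite ltnn mulr0 addr0 offsetS.
  case: (vertexP u) => [k h|i j x]; case: (vertexP v) => [k' h'|i' j' x'] //= _ euv.
  - by rewrite (e_minor euv).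
  - exact: (mixed _ _ _ _ _ euv).
  - by rewrite e_sym in euv; exact: (esym (mixed _ _ _ _ _ euv)).
rewrite -(ler_pM2l two0) double_energy.
apply: (@le_trans _ _ (\sum_i 2 * \sum_(j < (3 * m i).-1) F i j j.+1)).
  rewrite sum_vertex big1 ?add0r => [|k _]; last first.
    rewrite big1 // => h _; rewrite big1 // => v _.
    have [/flat ->|_] := boolP (e _ v); rewrite ?mul0r ?subrr ?expr0n ?mulr0 //.
    by case: v.
  apply: ler_sum => i _; rewrite -(sum_consecutive _ (FC i)); apply: ler_sum => j _.
  apply: (@le_trans _ _ (\sum_x \sum_k \sum_y
    (e (cell_vertex i j x) (cell_vertex i k y))%:R *
    (cell_potential i j - cell_potential i k) ^+ 2)).
    apply: ler_sum => x _; rewrite sum_vertex big1 ?add0r => [|k _]; last first.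
      rewrite big1 // => h _.
      have [/flat ->|_] := boolP (e _ _); rewrite ?mul0r ?subrr ?expr0n ?mulr0 //.
    rewrite (bigD1 i) //= [X in _ + X]big1 ?addr0 // => i' ii'.
    rewrite big1 // => k _; rewrite big1 // => y _.
    have [/e_cell[ii _]|_] := boolP (e _ _); rewrite ?mul0r //.
    by rewrite ii eqxx in ii'.
  rewrite exchange_big /=; apply: ler_sum => k _.
  set Q := _ ^+ 2; have Q0 : 0 <= Q := sqr_ge0 _.
  have FQ : \sum_(x < width i j) \sum_(y < width i k) Q = F i j k.
    rewrite /F -(sqrrN (_ - _)) opprB -/Q !sumr_const !card_ord.
    by rewrite -[Q *+ _ *+ _]mulr_natl -[Q *+ _]mulr_natl mulrA.
  have [kj|kj] := eqVneq (k : nat) j.+1.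
    rewrite mul1r; apply: ler_wpDr.
      by rewrite mulr_ge0 ?ler0n // /F mulr_ge0 ?sqr_ge0 // mulr_ge0 ?ler0n.
    rewrite -FQ.
    apply: ler_sum => x _; apply: ler_sum => y _.
    by rewrite ler_piMl // lern1 leq_b1.
  have [jk|jk] := eqVneq (j : nat) k.+1.
    rewrite mul0r mul1r add0r -FQ.
    apply: ler_sum => x _; apply: ler_sum => y _.
    by rewrite ler_piMl // lern1 leq_b1.
  rewrite !mul0r addr0 big1 // => x _; rewrite big1 // => y _.
  have [/e_cell[_]|_] := boolP (e _ _); rewrite ?mul0r //.
  rewrite (negbTE kj) (negbTE jk) !orbF => /eqP jk'.
  by rewrite /Q jk' subrr expr0n mulr0.
rewrite -mulr_sumr ler_pM2l //.
rewrite (sum_offset _ _ (fun p => (g p.+1 - g p) ^+ 2)) /= mulr_sumr.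
apply: ler_sum => i _.
rewrite stepsS (_ : (3 * (steps i).+1).-1 = (3 * steps i).+2)%N; last by lia.
have last0 j : (3 * steps i <= j)%N -> (j.+1 < 3 * (steps i).+1)%N -> F i j j.+1 = 0.
  move=> lej ltj; rewrite /F /cell_potential.
  have [-> ->] : (j %/ 3 = steps i /\ j.+1 %/ 3 = steps i)%N by lia.
  by rewrite ltnn !mulr0 subrr expr0n mulr0.
rewrite !(big_ord_recr _ (fun j => F i j j.+1)) /= !last0 ?addr0; try lia.
rewrite (sum_triple _ (fun j => F i j j.+1)) mulr_sumr; apply: ler_sum => k _.
have w3 : width i (3 * k).+3 = a i by rewrite -(width0 i k.+1) mulnS.
rewrite /F w3 width0 width1 width2.
have [-> -> ->] := period_potential (ltn_ord k).
have d0 : 0 < (d.+1%:R : R) by rewrite ltr0n.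
set D := g _ - g _.
apply: (@le_trans _ _ ((a i * b i * c i)%:R / d.+1%:R * D ^+ 2)); last first.
  by rewrite ler_wpM2r ?sqr_ge0 // ler_wpM2r ?invr_ge0 ?ler0n.
have eb : (b i)%:R = d.+1%:R - (a i)%:R - (c i)%:R :> R.
  by rewrite -(abc_sum i) !natrD; ring.
rewrite !natrM eb; move: (d.+1%:R : R) d0 => D' /gt_eqF/negbT D'0.
by rewrite le_eqVlt; apply/orP; left; apply/eqP; field.
Qed.

End TestFunction.

Lemma card_base_graph : #|V|%:R = (\sum_i m i * d.+1 + \sum_k #|H k|)%:R :> R.
Proof.
rewrite natrD -sumr_const (sum_period (fun=> 1)).
under [X in _ + X = _]eq_bigr => k _ do rewrite mulr1.
rewrite -natr_sum !sumr_const !card_ord; congr (_ + _); rewrite -natrD -natrM.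
have -> : (off t + t = \sum_i m i)%N.
  rewrite -{2}(card_ord t) -sum1_card /offset -big_split /=.
  by apply: eq_bigr => i _; rewrite stepsS addn1.
by rewrite -big_distrl /= mulnC.
Qed.

End BaseGraph.

(* What the estimates of [mu] use of the family: [G] is mapped onto a path with
   [last_layer.+1] vertices of mass about [d.+1], and energies compare with that
   path in both directions. *)
Record layering (R : rcfType) (d C : nat) (lmin lmax : R) (G : sgraph) := Layering {
  last_layer : nat;
  layer : G -> nat;
  sum_layer_ge : forall F : nat -> R, (forall p, 0 <= F p) ->
    d.+1%:R * \sum_(p < last_layer.+1) F p <= \sum_x F (layer x);
  sum_layer_le : forall (F : nat -> R) (B : R), (forall p, 0 <= F p) ->
    (forall p, (p <= last_layer)%N -> F p <= B) ->
    \sum_x F (layer x) <=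
    d.+1%:R * \sum_(p < last_layer.+1) F p + (d.+2 * C)%:R * B;
  layer_profile : forall f : G -> R, exists (S : nat -> R) (c0 : R),
    \sum_(p < last_layer) (S p.+1 - S p) ^+ 2 <= d.+1%:R / lmin * energy adj f /\
    forall x, (f x - S (layer x) - c0) ^+ 2 <= (6 * C + 2)%:R ^+ 2 * energy adj f;
  layer_test : forall g : nat -> R, exists f : G -> R,
    energy adj f <= lmax / d.+1%:R * \sum_(p < last_layer) (g p.+1 - g p) ^+ 2 /\
    forall x, (f x - g (layer x)) ^+ 2 <= (g (layer x).+1 - g (layer x)) ^+ 2
}.

(** * Transport from the base graph to a graph of the family *)

Section Decomposition.
Variables (R : rcfType) (n d C : nat) (G : sgraph).
Variable D : family_decomposition n d C G.

Let V := base_graph (@len _ _ _ _ D) (@pa _ _ _ _ D) (@pb _ _ _ _ D)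
  (@pc _ _ _ _ D) (@minor _ _ _ _ D).
Let phi : V -> G := @emb _ _ _ _ D.
Let e : rel V := fun u v => adj (phi u) (phi v).

Lemma decomposition_card : #|G| = n.
Proof.
rewrite -(bij_eq_card (emb_bij D)) -[RHS](order_eq D); apply/eqP; rewrite -(eqr_nat R).
apply/eqP; exact: (@card_base_graph R _ _ _ _ _ _ _ _ (nmajor_gt0 D) (nmajor_le D)
  (@params_gt0 _ _ _ _ D) (@params_sum _ _ _ _ D) (minor_le D)).
Qed.

Lemma decomposition_layering (lmin lmax : R) : 0 < lmin ->
  (forall i, lmin <= (abc D i)%:R <= lmax) -> inhabited (layering d C lmin lmax G).
Proof.
move=> lmin0 labc; have [psi phiK psiK] := emb_bij D.
have e_sym : symmetric e by move=> u v; exact: adj_sym.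
have adj_e (u v : V) : adj u v -> e u v := @emb_adj _ _ _ _ D u v.
have e_adj (u v : V) : e u v -> adj u v || may_add u v := @emb_new _ _ _ _ D u v.
have e_conn u v : connect e u v.
  rewrite -(phiK u) -(phiK v); apply: connect_homo (G_connected D _ _) => x y.
  by rewrite /e /phi !psiK.
have params0 := @params_gt0 _ _ _ _ D.
have psum := @params_sum _ _ _ _ D.
have t0 := nmajor_gt0 D; have tC := nmajor_le D; have HC := minor_le D.
have sumE (F : G -> R) : \sum_x F x = \sum_v F (phi v).
  by rewrite (reindex phi) //; exists psi => ? _; [exact: phiK | exact: psiK].
have energyE (f : G -> R) : energy adj f = energy e (f \o phi).
  by rewrite /energy sumE; congr (_ * _); apply: eq_bigr => u _; rewrite sumE.
have [abcmin abcmax] : (forall i : 'I_(nmajor D), lmin <= (pa i * pb i * pc i)%:R) /\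
    (forall i : 'I_(nmajor D), (pa i * pb i * pc i)%:R <= lmax :> R).
  by split=> i; have /andP[] := labc i.
pose layer x := period (psi x).
pose M := offset (steps (@len _ _ _ _ D)) (nmajor D).
refine (inhabits (@Layering R d C lmin lmax G M layer _ _ _ _)); rewrite /layer /M.
- move=> F F0; rewrite sumE.
  under [X in _ <= X]eq_bigr => v _ do rewrite /= phiK.
  exact: (@sum_period_ge R _ _ _ _ _ _ _ _ t0 tC params0 psum HC F F0).
- move=> F B F0 FB; rewrite sumE.
  under eq_bigr => v _ do rewrite /= phiK.
  exact: (@sum_period_le R _ _ _ _ _ _ _ _ t0 tC params0 psum HC F B F0 FB).
- move=> f; set fV := f \o phi.
  have s0 : 0 <= Num.sqrt (energy e fV) := sqrtr_ge0 _.
  have sE : energy e fV <= Num.sqrt (energy e fV) ^+ 2.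
    by rewrite sqr_sqrtr // energy_ge0.
  have [c0 close] := profile_close t0 tC params0 HC e_sym adj_e e_adj e_conn s0 sE.
  exists (profile fV), c0; rewrite energyE; split.
    exact: (profile_energy t0 tC params0 psum HC e_sym adj_e fV lmin0 abcmin).
  move=> x; have := close (psi x); rewrite /fV /= /phi psiK.
  rewrite -(ler_pXn2r (isT : (0 < 2)%N)) ?nnegrE ?mulr_ge0 ?ler0n //.
  by rewrite real_normK ?num_real // exprMn sqr_sqrtr ?energy_ge0.
move=> g; exists (test_function d g \o psi); split.
  rewrite energyE.
  have -> : energy e ((test_function d g \o psi) \o phi) = energy e (test_function d g).
    by congr (_ * _); apply: eq_bigr => u _; apply: eq_bigr => v _; rewrite /= !phiK.
  exact: (test_function_energy t0 tC params0 psum HC e_sym e_adj g abcmax).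
move=> x; exact: (test_function_close t0 tC psum HC g (psi x)).
Qed.

End Decomposition.

From mathcomp Require Import all_classical all_reals all_analysis.
Import Order.TTheory GRing.Theory Num.Theory.
Import numFieldNormedType.Exports.
Local Open Scope classical_set_scope.
Local Open Scope ring_scope.

(** * The spectral gap of a path *)

Section Path.
Variable R : realType.
Implicit Types (N p : nat) (g h : nat -> R).

Lemma dirichlet_path N h : (1 < N)%N -> h 0%N = 0 -> h N = 0 ->
  (2 - 2 * cos (pi / N%:R)) * \sum_(p < N) h p ^+ 2
  <= \sum_(p < N) (h p.+1 - h p) ^+ 2.
Proof.
case: N => [|[|N]] // _ h0 hN; set th := pi / _.
have N0 : (N.+2%:R : R) != 0 by rewrite pnatr_eq0.
have N0' : 0 < (N.+2%:R : R) by rewrite ltr0n.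
have th0 : 0 < th by rewrite divr_gt0 ?pi_gt0.
pose s p := sin (th * p%:R).
have s_gt0 p : (0 < p < N.+2)%N -> 0 < s p.
  case/andP=> p0 pN; apply: sin_gt0_pi; rewrite mulr_gt0 ?ltr0n //=.
  by rewrite /th mulrAC ltr_pdivrMr // ltr_pM2l ?pi_gt0 // ltr_nat.
have s0 : s 0%N = 0 by rewrite /s mulr0 sin0.
have sN : s N.+2 = 0 by rewrite /s /th divfK // sinpi.
have srec p : s p.+2 + s p = 2 * cos th * s p.+1.
  rewrite /s -(addn2 p) -(addn1 p) !natrD.
  rewrite (_ : th * (p%:R + 2) = th * (p%:R + 1) + th); last by ring.
  rewrite (_ : th * p%:R = th * (p%:R + 1) - th); last by ring.
  by rewrite sinD sinB; ring.
(* Jacobi's transformation: [s] is the positive ground state. *)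
have step p : (p < N)%N ->
    h p.+2 ^+ 2 * (1 - s p.+1 / s p.+2) - h p.+1 ^+ 2 * (s p.+2 / s p.+1 - 1)
    <= (h p.+2 - h p.+1) ^+ 2.
  move=> pN; have a0 : 0 < s p.+1 by apply: s_gt0; rewrite ltnS leqW // ltnW.
  have b0 : 0 < s p.+2 by apply: s_gt0; rewrite !ltnS.
  set a := s p.+1 in a0 *; set b := s p.+2 in b0 *.
  rewrite -subr_ge0.
  rewrite (_ : _ - _ = (a * h p.+2 - b * h p.+1) ^+ 2 / (a * b)).
    by rewrite divr_ge0 ?sqr_ge0 // mulr_ge0 ?ltW.
  by field; rewrite !gt_eqF.
(* [step] is summed from the left end. The coefficient collected for each interior [h q ^+ 2] is 2 -
   (s (q+1) + s (q-1)) / s q, which [srec] evaluates. *)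
have ind p : (p <= N)%N ->
    h p.+1 ^+ 2 * (1 - s p / s p.+1) <=
    \sum_(q < p.+1) (h q.+1 - h q) ^+ 2
      - (2 - 2 * cos th) * \sum_(q < p.+1) h q ^+ 2.
  elim: p => [_|p IH pN].
    by rewrite !big_ord1 h0 s0 mul0r subr0 mulr1 subr0 expr0n mulr0 subr0.
  have {IH} IH := IH (ltnW pN).
  rewrite !(big_ord_recr p.+1) /=.
  have := step p pN.
  have := s_gt0 p.+1; rewrite ltnS leqW ?(ltnW pN) // => /(_ isT) a0.
  have : s p.+2 / s p.+1 = 2 * cos th - s p / s p.+1.
    by rewrite -[s p.+2](addrK (s p)) srec mulrBl mulfK // gt_eqF.
  by move=> ->; move: IH; set A := \sum_(q < _) _; set B := \sum_(q < _) _; nra.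
rewrite -subr_ge0 !(big_ord_recr N.+1) /=.
have := ind N (leqnn _); rewrite hN sub0r sqrrN.
have := s_gt0 N.+1; rewrite ltnSn => /(_ isT) a0.
have : s N / s N.+1 = 2 * cos th.
  have aN0 : s N.+1 != 0 by rewrite gt_eqF.
  by apply: (mulIf aN0); rewrite divfK // -srec sN add0r.
by move=> ->; set A := \sum_(q < _) _; set B := \sum_(q < _) _; nra.
Qed.

(* The partial sums of a mean-zero [g] vanish at both ends, which reduces this to
   [dirichlet_path] by summation by parts. *)
Lemma path_poincare N g : (0 < N)%N -> \sum_(p < N) g p = 0 ->
  (2 - 2 * cos (pi / N%:R)) * \sum_(p < N) g p ^+ 2
  <= \sum_(p < N.-1) (g p.+1 - g p) ^+ 2.
Proof.
case: N => [|[|M]] //= _ g0.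
  by move: g0; rewrite !big_ord1 big_ord0 => ->; rewrite expr0n mulr0.
pose h p : R := \sum_(q < p) g q.
have h0 : h 0%N = 0 by rewrite /h big_ord0.
have := dirichlet_path (isT : (1 < M.+2)%N) h0 g0.
set lam := 2 - _; have lam0 : 0 <= lam.
  by rewrite /lam -{1}[2]mulr1 -mulrBr mulr_ge0 // subr_ge0 cos_le1.
under [X in _ <= X]eq_bigr => p _ do rewrite /h big_ord_recr /= addrAC subrr add0r.
set S := \sum_(p < _) g p ^+ 2; set D := \sum_(p < M.+1) _ => le1.
have parts m : \sum_(p < m.+1) g p ^+ 2 =
    h m.+1 * g m - \sum_(p < m) h p.+1 * (g p.+1 - g p).
  elim: m => [|m IH].
    by rewrite !big_ord_recr !big_ord0 /h big_ord1 /=; ring.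
  rewrite big_ord_recr IH [X in _ = _ - X]big_ord_recr /=.
  by rewrite {3}/h big_ord_recr /= -/(h m.+1); ring.
have eS : S = - \sum_(p < M.+1) h p.+1 * (g p.+1 - g p).
  by rewrite /S parts [h _]g0 mul0r sub0r.
(* Comes from 0 <= (lam h + increment of g)^2. As [le1] gives lam * sum h^2 <= S, one of the two
   copies of lam * S cancels. *)
have le2 : lam * S + lam * S <= lam ^+ 2 * \sum_(p < M.+1) h p.+1 ^+ 2 + D.
  have -> : lam * S + lam * S = - 2 * lam * - S by ring.
  rewrite eS opprK /D !mulr_sumr -big_split /=.
  by apply: ler_sum => p _; have := sqr_ge0 (lam * h p.+1 + (g p.+1 - g p)); lra.
have : lam * (lam * \sum_(p < M.+1) h p.+1 ^+ 2) <= lam * S.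
  apply: ler_wpM2l => //; move: le1.
  by rewrite big_ord_recl h0 expr0n add0r.
by rewrite mulrA -expr2; lra.
Qed.

(** Multiplied by 2 sin th the sum telescopes, and between its two ends the argument makes one full
    turn. The condition 1 < N keeps sin th away from 0. *)
Lemma sum_cos_period N (phi : R) : (1 < N)%N ->
  \sum_(p < N) cos (2 * (pi / N%:R) * p%:R + phi) = 0.
Proof.
move=> N1; set th := pi / _.
have N0 : 0 < (N%:R : R) by rewrite ltr0n ltnW.
have s0 : 2 * sin th != 0.
  rewrite mulf_neq0 ?pnatr_eq0 // gt_eqF // sin_gt0_pi // divr_gt0 ?pi_gt0 //=.
  by rewrite /th ltr_pdivrMr // ltr_pMr ?pi_gt0 // ltr1n.
apply: (mulfI s0); rewrite mulr0 mulr_sumr.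
have tel m : \sum_(p < m) 2 * sin th * cos (2 * th * p%:R + phi) =
    sin (th * (2 * m%:R - 1) + phi) - sin (phi - th).
  elim: m => [|m IH].
    by rewrite big_ord0 mulr0 sub0r mulrN1 [- _ + _]addrC subrr.
  rewrite big_ord_recr IH /=.
  rewrite (_ : th * (2 * m.+1%:R - 1) + phi = (2 * th * m%:R + phi) + th); last first.
    by rewrite -[m.+1%:R]natr1; ring.
  rewrite (_ : th * (2 * m%:R - 1) + phi = (2 * th * m%:R + phi) - th); last by ring.
  by set x := 2 * th * _ + phi; rewrite (sinB x) (sinD x); ring.
rewrite tel (_ : _ + phi = (phi - th) + pi *+ 2); last first.
  by rewrite -mulr_natl /th; field; rewrite gt_eqF.
by rewrite sinD2pi subrr.
Qed.

Lemma sin_mean_value (x : R) : 0 < x ->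
  exists2 c : R, 0 < c < x & sin x = x * cos c.
Proof.
move=> x0.
have csin : {within `[0, x], continuous (@sin R)}.
  by apply: continuous_subspaceT => y; exact: continuous_sin.
have [c] := MVT x0 (fun y _ => is_derive_sin y) csin.
by rewrite in_itv /= sin0 !subr0 => cx ->; exists c; rewrite // mulrC.
Qed.

Lemma two_sub_two_cos (x : R) : 2 - 2 * cos x = (2 * sin (x / 2)) ^+ 2.
Proof.
have -> : cos x = cos (x / 2 *+ 2) by congr cos; rewrite -mulr_natl; field.
by rewrite cos_mulr2n exprMn sin2cos2 -mulr_natl; ring.
Qed.

Lemma two_sub_two_cos_le (x : R) : 0 < x -> 2 - 2 * cos x <= x ^+ 2.
Proof.
move=> x0; rewrite two_sub_two_cos.
have [c _ ->] : exists2 c : R, 0 < c < x / 2 & _ := sin_mean_value (divr_gt0 x0 (ltr0n R 2)).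
rewrite (_ : 2 * (x / 2 * cos c) = x * cos c); last by field.
rewrite exprMn ler_piMr ?sqr_ge0 // cos2sin2 gerBl; exact: sqr_ge0.
Qed.

(** sin (x/2) = (x/2) cos c with 0 < c < x/2, and the upper bound [two_sub_two_cos_le] at c gives
    cos c >= 1 - x^2/8, whose square is at least 1 - x^2/4. For x^2 > 8 the left side is
    negative. *)
Lemma two_sub_two_cos_ge (x : R) : 0 < x ->
  x ^+ 2 * (1 - x ^+ 2 / 4) <= 2 - 2 * cos x.
Proof.
move=> x0; rewrite two_sub_two_cos.
have [c /andP[c0 cx] ->] := sin_mean_value (divr_gt0 x0 (ltr0n R 2)).
have cos1 := two_sub_two_cos_le c0.
have cb : c ^+ 2 <= x ^+ 2 / 4 by nra.
have cos2 : 1 - x ^+ 2 / 8 <= cos c by lra.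
rewrite (_ : 2 * (x / 2 * cos c) = x * cos c); last by field.
rewrite exprMn ler_wpM2l ?sqr_ge0 //.
have [x4|x4] := lerP (x ^+ 2) 8; last by have := sqr_ge0 (cos c); lra.
apply: le_trans (_ : (1 - x ^+ 2 / 8) ^+ 2 <= _); last by rewrite ler_sqr ?nnegrE; lra.
by have := sqr_ge0 (x ^+ 2); nra.
Qed.

Lemma cos_lt1_pi (x : R) : 0 < x <= pi -> cos x < 1.
Proof.
by move=> /andP[x0 xpi]; rewrite -cos0 ltr_cos // in_itv /= ?lexx ?pi_ge0 ?(ltW x0).
Qed.

(** The eigenvector of the path on [N] vertices for 2 - 2 cos (pi/N). The shift by 1/2 makes it even
    about -1/2 and N - 1/2, which is the free boundary condition. *)
Definition cosine_wave N p : R := cos (pi / N%:R * (p%:R + 2^-1)).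

Lemma cosine_wave_sum N : (1 < N)%N -> \sum_(p < N) cosine_wave N p = 0.
Proof.
move=> N1; have N0 : 0 < (N%:R : R) by rewrite ltr0n ltnW.
set th : R := pi / N%:R.
have th2 : 0 < th / 2 < pi.
  rewrite !divr_gt0 ?pi_gt0 //= /th -mulrA -invfM ltr_pdivrMr ?mulr_gt0 //.
  by rewrite ltr_pMr ?pi_gt0 // -natrM ltr1n muln2 -addnn ltn_addl.
have s0 : 2 * sin (th / 2) != 0 by rewrite mulf_neq0 ?pnatr_eq0 // gt_eqF // sin_gt0_pi.
apply: (mulfI s0); rewrite mulr0 mulr_sumr.
have tel m : \sum_(p < m) 2 * sin (th / 2) * cosine_wave N p = sin (th * m%:R).
  elim: m => [|m IH]; first by rewrite big_ord0 mulr0 sin0.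
  rewrite big_ord_recr IH /= /cosine_wave -/th.
  set x := th * (_ + _).
  rewrite (_ : th * m.+1%:R = x + th / 2); last by rewrite /x -[m.+1%:R]natr1; field.
  rewrite (_ : th * m%:R = x - th / 2); last by rewrite /x; ring.
  by rewrite (sinB x) (sinD x); ring.
by rewrite tel /th divfK ?sinpi // gt_eqF.
Qed.

Lemma cosine_wave_sum_sqr N : (1 < N)%N ->
  \sum_(p < N) cosine_wave N p ^+ 2 = N%:R / 2.
Proof.
move=> N1; have := sum_cos_period (pi / N%:R) N1.
under eq_bigr => p _.
  rewrite (_ : cos _ = 2 * cosine_wave N p ^+ 2 - 1); first over.
  rewrite (_ : _ + _ = (pi / N%:R * (p%:R + 2^-1)) *+ 2); last first.
    by rewrite -mulr_natl; field; rewrite pnatr_eq0 -lt0n ltnW.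
  by rewrite cos_mulr2n -/(cosine_wave N p) [in RHS]mulr_natl.
rewrite sumrB -mulr_sumr sumr_const card_ord; lra.
Qed.

Lemma cosine_wave_diff N p : cosine_wave N p.+1 - cosine_wave N p =
  - (2 * sin (pi / N%:R / 2)) * sin (pi / N%:R * p.+1%:R).
Proof.
rewrite /cosine_wave; set th := pi / N%:R; set x := th * p.+1%:R.
rewrite (_ : th * (p.+1%:R + 2^-1) = x + th / 2); last by rewrite /x; ring.
rewrite (_ : th * (p%:R + 2^-1) = x - th / 2); last by rewrite /x -[p.+1%:R]natr1; field.
by rewrite (cosB x) (cosD x); ring.
Qed.

Lemma cosine_wave_step N p : (0 < N)%N ->
  (cosine_wave N p.+1 - cosine_wave N p) ^+ 2 <= (pi / N%:R) ^+ 2.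
Proof.
move=> N0; have th0 : 0 < pi / N%:R :> R by rewrite divr_gt0 ?pi_gt0 ?ltr0n.
rewrite cosine_wave_diff exprMn sqrrN -two_sub_two_cos.
have := two_sub_two_cos_le th0; rewrite two_sub_two_cos.
set s := sin (_ * p.+1%:R); have : s ^+ 2 <= 1.
  by rewrite /s sin2cos2 gerBl sqr_ge0.
have := sqr_ge0 s; have := sqr_ge0 (2 * sin (pi / N%:R / 2)).
by set A := _ ^+ 2; set B := s ^+ 2; set D := _ ^+ 2; nra.
Qed.

Lemma cosine_wave_energy N : (1 < N)%N ->
  \sum_(p < N.-1) (cosine_wave N p.+1 - cosine_wave N p) ^+ 2
  <= (pi / N%:R) ^+ 2 * (N%:R / 2).
Proof.
move=> N1; have N0 : (0 < N)%N := ltnW N1.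
have th0 : 0 < pi / N%:R :> R by rewrite divr_gt0 ?pi_gt0 ?ltr0n.
under eq_bigr => p _ do rewrite cosine_wave_diff exprMn sqrrN -two_sub_two_cos.
rewrite -mulr_sumr.
have -> : \sum_(p < N.-1) sin (pi / N%:R * p.+1%:R) ^+ 2 = N%:R / 2 :> R.
  have -> : \sum_(p < N.-1) sin (pi / N%:R * p.+1%:R) ^+ 2 =
      \sum_(p < N) sin (pi / N%:R * p%:R) ^+ 2 :> R.
    by case: (N) N0 => //= M _; rewrite big_ord_recl mulr0 sin0 expr0n add0r.
  have := sum_cos_period 0 N1.
  under eq_bigr => p _.
    rewrite (_ : cos _ = 1 - 2 * sin (pi / N%:R * p%:R) ^+ 2); first over.
    rewrite sin2cos2 addr0 -mulrA [2 * (_ * _)]mulr_natl cos_mulr2n -mulr_natl.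
    by ring.
  rewrite sumrB -mulr_sumr sumr_const card_ord; lra.
by rewrite ler_wpM2r ?two_sub_two_cos_le // divr_ge0.
Qed.

End Path.

(** * Bounds for layered graphs *)

Section LayeredBounds.
Variable R : realType.

Lemma sqr_add_le (e x y : R) : 0 < e ->
  (x + y) ^+ 2 <= (1 + e) * x ^+ 2 + (1 + e^-1) * y ^+ 2.
Proof.
move=> e0; rewrite -subr_ge0.
rewrite (_ : _ - _ = (e * x - y) ^+ 2 / e); last by field; rewrite gt_eqF.
by rewrite divr_ge0 ?sqr_ge0 ?ltW.
Qed.

Lemma sqr_sum_le k (x : 'I_k -> R) : (\sum_i x i) ^+ 2 <= k%:R * \sum_i x i ^+ 2.
Proof.
case: k x => [|k] x; first by rewrite !big_ord0 expr0n mulr0.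
have k0 : 0 < k.+1%:R :> R by rewrite ltr0n.
(* Cauchy-Schwarz as the bipartite inequality against a single vertex of value 0. *)
have := sum_sqr_bipartite x (fun _ : 'I_1 => 0) isT isT.
under [X in _ <= X]eq_bigr => i _ do rewrite big_ord1 subr0.
rewrite big_ord1 mul0r subr0 mulr1 expr_div_n => le1.
rewrite -ler_pdivrMl //; apply: le_trans le1.
by rewrite le_eqVlt; apply/orP; left; apply/eqP; field; rewrite gt_eqF.
Qed.

Lemma range_le (S : nat -> R) M p : (p <= M)%N ->
  `|S p - S 0%N| <= \sum_(r < M) `|S r.+1 - S r|.
Proof.
move=> /subnKC <-; elim: (M - p)%N => [|k IH].
  rewrite addn0; elim: p => [|p IH]; first by rewrite subrr normr0 big_ord0.
  rewrite big_ord_recr /= addrC; apply: le_trans (ler_distD (S p) _ _) _.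
  by rewrite lerD2l.
by rewrite addnS big_ord_recr /=; apply: ler_wpDr.
Qed.

Variables (d C : nat) (lmin lmax : R) (G : sgraph).
Variable Lay : layering d C lmin lmax G.
Hypothesis lmin_gt0 : 0 < lmin.
Hypothesis lmax_ge0 : 0 <= lmax.
Hypothesis G_gt1 : (1 < #|G|)%N.

Local Notation M := (last_layer Lay).
Local Notation n := (#|G|%:R : R).
Local Notation th := (pi / M.+1%:R : R).
Local Notation K := ((6 * C + 2)%:R ^+ 2 : R).

Lemma layers_card :
  d.+1%:R * M.+1%:R <= n /\ n <= d.+1%:R * M.+1%:R + (d.+2 * C)%:R.
Proof.
have s1 : \sum_(p < M.+1) (1 : R) = M.+1%:R by rewrite sumr_const card_ord.
have s2 : \sum_(x : G) (1 : R) = n by rewrite sumr_const.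
split; first by rewrite -s1 -s2; apply: (sum_layer_ge Lay (F := fun=> 1)).
rewrite -s1 -s2 -[X in _ + X]mulr1.
exact: (@sum_layer_le _ _ _ _ _ _ Lay (fun=> 1) 1 (fun=> ler01) (fun _ _ => lexx 1)).
Qed.

Lemma sum_sqr_le_shift (f : G -> R) (k : R) : \sum_x f x = 0 ->
  \sum_x f x ^+ 2 <= \sum_x (f x - k) ^+ 2.
Proof.
move=> f0; have -> : \sum_x (f x - k) ^+ 2 =
    \sum_x f x ^+ 2 - 2 * k * \sum_x f x + \sum_(x : G) k ^+ 2.
  by rewrite mulr_sumr -sumrB -big_split; apply: eq_bigr => x _ /=; ring.
by rewrite f0 mulr0 subr0 lerDl; apply: sumr_ge0 => x _; exact: sqr_ge0.
Qed.

Lemma mu_ge0 : 0 <= mu R G.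
Proof. by apply: le_mu => // f _; rewrite mul0r energy_ge0. Qed.

(** Main term: the inverse gap of the path times the mass [d.+1], plus the surplus vertices at the
    crude bound 4 M D, both multiplied by the loss [d.+1 / lmin] from [layer_profile]. Last term:
    the pointwise error summed over all vertices. *)
Definition poincare_constant (e : R) : R :=
  (1 + e) * (d.+1%:R / (2 - 2 * cos th) + 4 * (d.+2 * C)%:R * M%:R) * (d.+1%:R / lmin)
  + (1 + e^-1) * (n * K).

Lemma th_gt0 : 0 < th.
Proof. by rewrite divr_gt0 ?pi_gt0 ?ltr0n. Qed.

Lemma gap_gt0 : 0 < 2 - 2 * cos th.
Proof.
have : cos th < 1.
  by rewrite cos_lt1_pi // th_gt0 ler_pdivrMr ?ltr0n // ler_peMr ?pi_ge0 // ler1n.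
lra.
Qed.

Lemma layered_poincare (e : R) (f : G -> R) : 0 < e -> \sum_x f x = 0 ->
  \sum_x f x ^+ 2 <= poincare_constant e * energy adj f.
Proof.
move=> e0 f0; have [S [c0 [DS close]]] := layer_profile Lay f.
pose E := energy adj f; rewrite -/E in DS close *.
have E0 : 0 <= E := energy_ge0 _ _.
have N0 : 0 < M.+1%:R :> R by rewrite ltr0n.
pose xm := (\sum_(p < M.+1) S p) / M.+1%:R; pose g p := S p - xm.
have g0 : \sum_(p < M.+1) g p = 0.
  by rewrite sumrB sumr_const card_ord -[xm *+ _]mulr_natr /xm divfK ?subrr.
set D := \sum_(p < M) _ in DS.
have D0 : 0 <= D by apply: sumr_ge0 => p _; exact: sqr_ge0.
have pg : (2 - 2 * cos th) * \sum_(p < M.+1) g p ^+ 2 <= D.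
  have := path_poincare (ltn0Sn M) g0.
  by under [X in _ <= X]eq_bigr => p _ do rewrite /g opprB addrA subrK.
(* A crude bound by the total variation, itself at most sqrt (M D); it is spent only on the
   boundedly many surplus vertices. *)
have gmax p : (p <= M)%N -> g p ^+ 2 <= 4 * M%:R * D.
  move=> pM; set A := \sum_(r < M) `|S r.+1 - S r|.
  have A2 : A ^+ 2 <= M%:R * D.
    apply: le_trans (sqr_sum_le _) _; rewrite ler_wpM2l ?ler0n //.
    by apply: ler_sum => r _; rewrite real_normK ?num_real.
  have : `|g p| <= 2 * A.
    apply: (mean_dist (ltn0Sn M)) => q; apply: le_trans (ler_distD (S 0%N) _ _) _.
    rewrite mulr_natl mulr2n lerD ?range_le // distrC range_le //.
    by rewrite -ltnS.
  rewrite -(ler_pXn2r (isT : (0 < 2)%N)) ?nnegrE ?mulr_ge0 ?sumr_ge0 //.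
  by rewrite real_normK ?num_real // exprMn -natrX; lra.
have gl : \sum_x g (layer Lay x) ^+ 2 <=
    (d.+1%:R / (2 - 2 * cos th) + 4 * (d.+2 * C)%:R * M%:R) * D.
  apply: le_trans (@sum_layer_le _ _ _ _ _ _ Lay (fun p => g p ^+ 2) _
    (fun p => sqr_ge0 (g p)) gmax) _.
  rewrite [X in _ <= X]mulrDl; apply: lerD; last first.
    by rewrite le_eqVlt; apply/orP; left; apply/eqP; ring.
  by rewrite -mulrA ler_wpM2l ?ler0n // mulrC ler_pdivlMr ?gap_gt0 // mulrC.
apply: le_trans (sum_sqr_le_shift (c0 + xm) f0) _.
apply: (@le_trans _ _ (\sum_x ((1 + e) * g (layer Lay x) ^+ 2 +
    (1 + e^-1) * (K * E)))).
  apply: ler_sum => x _.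
  have -> : f x - (c0 + xm) = g (layer Lay x) + (f x - S (layer Lay x) - c0).
    by rewrite /g; ring.
  apply: le_trans (sqr_add_le _ _ e0) _; rewrite lerD2l ler_wpM2l //.
  by rewrite addr_ge0 // invr_ge0 ltW.
rewrite big_split /= -mulr_sumr sumr_const -[X in _ + X]mulr_natl.
rewrite /poincare_constant [X in _ <= X]mulrDl; apply: lerD; last first.
  by rewrite le_eqVlt; apply/orP; left; apply/eqP; ring.
rewrite -(mulrA _ _ E) -(mulrA (1 + e)) ler_wpM2l ?addr_ge0 ?(ltW e0) //.
apply: le_trans gl _; rewrite ler_wpM2l // addr_ge0 ?mulr_ge0 ?ler0n //.
Qed.

Lemma poincare_constant_gt0 (e : R) : 0 < e -> 0 < poincare_constant e.
Proof.
move=> e0; have n0 : 0 < n by rewrite ltr0n ltnW.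
have K0 : 0 < K by rewrite exprn_gt0 // ltr0n addn2.
apply: ltr_wpDl; last by rewrite !mulr_gt0 // addr_gt0 // invr_gt0.
have q1 : 0 <= d.+1%:R / lmin by rewrite divr_ge0 ?ler0n ?ltW.
have q2 : 0 <= d.+1%:R / (2 - 2 * cos th) by rewrite divr_ge0 ?ler0n ?ltW ?gap_gt0.
have q3 : 0 <= 4 * (d.+2 * C)%:R * M%:R :> R by rewrite !mulr_ge0.
by rewrite mulr_ge0 // mulr_ge0 // addr_ge0 // ltW.
Qed.

Lemma mu_ge_layered (e : R) : 0 < e -> (poincare_constant e)^-1 <= mu R G.
Proof.
move=> e0; apply: le_mu => // f f0.
by rewrite ler_pdivrMl ?poincare_constant_gt0 // layered_poincare.
Qed.

(** The test function [f] is centred to [f - k] before use. The wave has zero sum over the path, so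
    shifting it by [k] cannot decrease its sum of squares, and [k] never has to be estimated. *)
Lemma mu_le_layered (e : R) : 0 < e -> (0 < M)%N ->
  mu R G * (d.+1%:R * (M.+1%:R / 2) - (1 + e^-1) * (n * th ^+ 2)) <=
  (1 + e) * (lmax / d.+1%:R * (th ^+ 2 * (M.+1%:R / 2))).
Proof.
move=> e0 M0; pose g := @cosine_wave R M.+1.
have N1 : (1 < M.+1)%N by [].
have [f [Ef close]] := layer_test Lay g.
have n0 : n != 0 by rewrite pnatr_eq0 -lt0n ltnW.
have e1 : 0 <= 1 + e by rewrite addr_ge0 // ltW.
pose k := (\sum_x f x) / n.
have fk0 : \sum_x (f x - k) = 0.
  by rewrite sumrB sumr_const -[k *+ _]mulr_natr /k divfK // subrr.
have := mu_le_energy G_gt1 fk0.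
have -> : energy adj (fun x => f x - k) = energy adj f.
  congr (_ * _); apply: eq_bigr => x _; apply: eq_bigr => y _.
  by rewrite opprB addrA subrK.
set X := \sum_x _ => muX.
have Xge : d.+1%:R * (M.+1%:R / 2) - (1 + e^-1) * (n * th ^+ 2) <= (1 + e) * X.
  rewrite lerBlDr.
  apply: (@le_trans _ _ (\sum_x (g (layer Lay x) - k) ^+ 2)).
    apply: le_trans (@sum_layer_ge _ _ _ _ _ _ Lay (fun p => (g p - k) ^+ 2)
      (fun p => sqr_ge0 (g p - k))).
    rewrite ler_wpM2l ?ler0n // -cosine_wave_sum_sqr //.
    have -> : \sum_(p < M.+1) (g p - k) ^+ 2 = \sum_(p < M.+1) g p ^+ 2
        - 2 * k * \sum_(p < M.+1) g p + \sum_(p < M.+1) k ^+ 2.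
      by rewrite mulr_sumr -sumrB -big_split; apply: eq_bigr => p _ /=; ring.
    rewrite cosine_wave_sum // mulr0 subr0 lerDl.
    by apply: sumr_ge0 => p _; exact: sqr_ge0.
  have -> : n * th ^+ 2 = \sum_(x : G) th ^+ 2 by rewrite sumr_const mulr_natl.
  rewrite /X !mulr_sumr -big_split; apply: ler_sum => x _ /=.
  have -> : g (layer Lay x) - k = (f x - k) - (f x - g (layer Lay x)) by ring.
  apply: le_trans (sqr_add_le _ _ e0) _; rewrite lerD2l sqrrN ler_wpM2l //.
    by rewrite addr_ge0 // invr_ge0 ltW.
  by apply: le_trans (close x) _; exact: cosine_wave_step.
apply: le_trans (ler_wpM2l mu_ge0 Xge) _.
rewrite mulrCA ler_wpM2l //; apply: le_trans muX _; apply: le_trans Ef _.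
apply: ler_wpM2l; [by rewrite divr_ge0 | exact: (cosine_wave_energy R N1)].
Qed.

Local Notation c := ((d.+2 * C)%:R : R).

(** * Explicit thresholds on the order of the graph *)

Section Asymptotics.
Variable e : R.
Hypothesis e_gt0 : 0 < e.
Hypothesis e_le : e <= 4^-1.

(** The first summand makes all O(n) errors at most e n^2, the second forces th^2 <= 4e, and the
    last covers the surplus in [layers_card]. Here (d+1)^3 stands in for [lmin], so that the value
    depends only on d, C and e. *)
Definition lower_threshold : R :=
  ((1 + e) * (4 * c * pi ^+ 2) + (1 + e^-1) * (K * (d.+1%:R ^+ 3 * pi ^+ 2))) / e
  + d.+1%:R * (pi ^+ 2 / (4 * e)) + c.

(** The constant times lmin * pi^2 is at most (1 + 5e) n^2: 4e from (1 + e)/(1 - e), e from the O(n)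
    errors. Then (1 - 16e)(1 + 5e) <= 1. *)
Lemma mu_ge_asymptotic : lmin <= d.+1%:R ^+ 3 -> lower_threshold <= n ->
  (1 - 16 * e) * (lmin * pi ^+ 2 / n ^+ 2) <= mu R G.
Proof.
rewrite /lower_threshold => lminD; have [eg el] := (e_gt0, e_le).
set A := _ + (1 + e^-1) * _ => nX.
have [h1 h2] := layers_card.
have P0 : 0 < pi ^+ 2 :> R by rewrite exprn_gt0 ?pi_gt0.
set P : R := pi ^+ 2 in A nX P0 *.
have D0 : 0 < d.+1%:R :> R by rewrite ltr0n.
have N1 : 1 <= M.+1%:R :> R by rewrite ler1n.
have N0 : 0 < M.+1%:R :> R by rewrite ltr0n.
have n0 : 0 < n by rewrite ltr0n ltnW.
have c0 : 0 <= c := ler0n _ _.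
have K0 : 0 <= K by rewrite exprn_ge0 ?ler0n.
have e1 : 0 < 1 - e by lra.
have ei0 : 0 < e^-1 by rewrite invr_gt0.
have A0 : 0 <= A.
  rewrite /A; apply: addr_ge0.
    by rewrite mulr_ge0 ?addr_ge0 ?(ltW eg) // mulr_ge0 ?(ltW P0) // mulr_ge0.
  rewrite mulr_ge0 ?addr_ge0 ?(ltW ei0) // mulr_ge0 // mulr_ge0 ?(ltW P0) //.
have Ae0 : 0 <= A / e by rewrite divr_ge0 // ltW.
have Q0 : 0 <= d.+1%:R * (P / (4 * e)) by rewrite ltW // mulr_gt0 // divr_gt0 // mulr_gt0.
have nA : A <= e * n by rewrite mulrC -ler_pdivrMr //; lra.
have NP : P / (4 * e) <= M.+1%:R.
  by rewrite -(ler_pM2l D0); lra.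
have th4 : th ^+ 2 <= 4 * e.
  rewrite expr_div_n -/P ler_pdivrMr ?exprn_gt0 //.
  move: NP; rewrite ler_pdivrMr ?mulr_gt0 // => NP.
  apply: le_trans NP _; rewrite mulrC ler_pM2l ?mulr_gt0 // expr2.
  by rewrite ler_peMr ?(ltW N0).
have gap : P / M.+1%:R ^+ 2 * (1 - e) <= 2 - 2 * cos th.
  rewrite /P -expr_div_n; apply: le_trans (two_sub_two_cos_ge th_gt0).
  by rewrite ler_wpM2l ?sqr_ge0 //; move: th4; set q := th ^+ 2; lra.
have gapD : d.+1%:R / (2 - 2 * cos th) * d.+1%:R * P <= n ^+ 2 / (1 - e).
  rewrite [X in X <= _](_ : _ = (d.+1%:R ^+ 2 * P) / (2 - 2 * cos th)); last by ring.
  rewrite ler_pdivrMr ?gap_gt0 //.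
  apply: le_trans (ler_wpM2l _ gap); last by rewrite divr_ge0 ?exprn_ge0 ?(ltW e1) ?(ltW n0).
  rewrite [X in _ <= X](_ : _ = (n ^+ 2 / M.+1%:R ^+ 2) * P); last by field; rewrite !gt_eqF.
  rewrite ler_pM2r // ler_pdivlMr ?exprn_gt0 // -exprMn.
  by rewrite ler_pXn2r ?nnegrE ?mulr_ge0 ?(ltW n0) ?(ltW D0) ?(ltW N0).
have MD : M%:R * d.+1%:R <= n.
  by apply: le_trans h1; rewrite mulrC ler_pM2l // ler_nat.
have W_le : poincare_constant e * (lmin * P) <= (1 + 5 * e) * n ^+ 2.
  apply: (@le_trans _ _ ((1 + e) * (n ^+ 2 / (1 - e)) + n * A)).
    rewrite /poincare_constant.
    rewrite [X in X <= _](_ : _ = (1 + e) * (d.+1%:R / (2 - 2 * cos th) * d.+1%:R * P)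
      + ((1 + e) * (4 * c * P * (M%:R * d.+1%:R))
      + n * ((1 + e^-1) * (K * (lmin * P))))); last first.
      by field; rewrite !gt_eqF ?gap_gt0.
    apply: lerD; first by rewrite ler_wpM2l // addr_ge0 ?(ltW eg).
    rewrite /A mulrDr; apply: lerD.
      rewrite [X in _ <= X](_ : _ = (1 + e) * (4 * c * P * n)); last by ring.
      rewrite ler_wpM2l ?addr_ge0 ?(ltW eg) //.
      have cP : 0 <= 4 * c * P by rewrite mulr_ge0 ?(ltW P0) // mulr_ge0.
      exact: ler_wpM2l.
    rewrite ler_wpM2l ?(ltW n0) // ler_wpM2l ?addr_ge0 ?(ltW ei0) //.
    by rewrite ler_wpM2l // ler_wpM2r // ltW.
  have nAn : n * A <= e * n ^+ 2.
    by rewrite expr2 mulrA [X in _ <= X]mulrC ler_wpM2l ?(ltW n0).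
  suff : (1 + e) * (n ^+ 2 / (1 - e)) <= (1 + 4 * e) * n ^+ 2 by lra.
  rewrite mulrCA mulrC ler_wpM2r ?exprn_ge0 ?(ltW n0) // ler_pdivrMr //.
  by nra.
have W0 := poincare_constant_gt0 e_gt0.
apply: le_trans (mu_ge_layered e_gt0).
rewrite -[X in _ <= X]mul1r ler_pdivlMr //.
rewrite [X in X <= _](_ : _ =
  (1 - 16 * e) * (poincare_constant e * (lmin * P) / n ^+ 2)); last by ring.
have WP0 : 0 <= poincare_constant e * (lmin * P) / n ^+ 2.
  by rewrite divr_ge0 ?exprn_ge0 ?(ltW n0) // mulr_ge0 ?(ltW W0) // mulr_ge0 ?ltW.
have WP : poincare_constant e * (lmin * P) / n ^+ 2 <= 1 + 5 * e.
  by rewrite ler_pdivrMr ?exprn_gt0.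
by move: WP0 WP; set w := _ / _; nra.
Qed.

(** The first summand makes the interpolation error a fraction e of the main term, the second gives
    c <= e n and n <= 2 (d+1)(M+1), and the third ensures that the path has an edge. *)
Definition upper_threshold : R :=
  d.+1%:R * (4 * (1 + e^-1) * pi ^+ 2 / e) + (2 + e^-1) * c + 2 * d.+1%:R.

(** One factor 1 - e is lost to the interpolation error, two more to the square of (1 - e) n <=
    (d+1)(M+1). *)
Lemma mu_le_asymptotic : upper_threshold <= n ->
  mu R G <= (1 + 16 * e) * (lmax * pi ^+ 2 / n ^+ 2).
Proof.
rewrite /upper_threshold => nX; have [eg el] := (e_gt0, e_le).
have [h1 h2] := layers_card.
have P0 : 0 < pi ^+ 2 :> R by rewrite exprn_gt0 ?pi_gt0.
have muM := mu_le_layered e_gt0.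
set P : R := pi ^+ 2 in nX P0 *.
have D0 : 0 < d.+1%:R :> R by rewrite ltr0n.
have N1 : 1 <= M.+1%:R :> R by rewrite ler1n.
have N0 : 0 < M.+1%:R :> R by rewrite ltr0n.
have n0 : 0 < n by rewrite ltr0n ltnW.
have c0 : 0 <= c := ler0n _ _.
have ei0 : 0 < e^-1 by rewrite invr_gt0.
have e1 : 0 < 1 - e by lra.
have eic : 0 <= e^-1 * c by rewrite mulr_ge0 ?(ltW ei0).
have Q0 : 0 <= d.+1%:R * (4 * (1 + e^-1) * P / e).
  by rewrite ltW // mulr_gt0 // divr_gt0 // mulr_gt0 // mulr_gt0 // addr_gt0.
have M0 : (0 < M)%N.
  rewrite -ltnS -(ltr_nat R) -(ltr_pM2l D0) mulr1; lra.
have {}muM := muM M0.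
have N_ge : 4 * (1 + e^-1) * P / e <= M.+1%:R by rewrite -(ler_pM2l D0); lra.
have n_le : n <= 2 * (d.+1%:R * M.+1%:R) by lra.
have DN : (1 - e) * n <= d.+1%:R * M.+1%:R.
  have : c <= e * n.
    rewrite mulrC -ler_pdivrMr // mulrC; lra.
  lra.
have err : (1 + e^-1) * (n * th ^+ 2) <= e * (d.+1%:R * (M.+1%:R / 2)).
  apply: (@le_trans _ _ ((1 + e^-1) * (2 * (d.+1%:R * M.+1%:R) * th ^+ 2))).
    by rewrite ler_wpM2l ?addr_ge0 ?(ltW ei0) // ler_wpM2r ?exprn_ge0 ?(ltW th_gt0).
  rewrite expr_div_n -/P.
  rewrite [X in X <= _](_ : _ =
    (4 * (1 + e^-1) * P / e) * (e * d.+1%:R / (2 * M.+1%:R))); last first.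
    by field; rewrite !gt_eqF.
  rewrite [X in _ <= X](_ : _ = M.+1%:R ^+ 2 * (e * d.+1%:R / (2 * M.+1%:R))); last first.
    by field; rewrite !gt_eqF.
  rewrite ler_wpM2r ?divr_ge0 ?mulr_ge0 ?(ltW e_gt0) ?(ltW D0) ?(ltW N0) //.
  by apply: le_trans N_ge _; rewrite expr2 ler_peMr ?(ltW N0).
have mu0 := mu_ge0.
have mu1 : mu R G * ((1 - e) * (d.+1%:R * (M.+1%:R / 2))) <=
    (1 + e) * (lmax / d.+1%:R * (th ^+ 2 * (M.+1%:R / 2))).
  apply: le_trans muM; rewrite ler_wpM2l //; move: err.
  by set x := (1 + e^-1) * _; set y := _ * (_ / 2); lra.
have mu2 : mu R G * (1 - e) * (d.+1%:R * M.+1%:R) ^+ 2 <= (1 + e) * (lmax * P).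
  have k0 : 0 < 2 * d.+1%:R * M.+1%:R :> R by rewrite !mulr_gt0.
  have := ler_wpM2r (ltW k0) mu1; rewrite expr_div_n -/P.
  rewrite [X in _ <= X -> _](_ : _ = (1 + e) * (lmax * P)); last by field; rewrite !gt_eqF.
  by apply: le_trans; rewrite le_eqVlt; apply/orP; left; apply/eqP; field.
have mu3 : mu R G * ((1 - e) ^+ 3 * n ^+ 2) <= (1 + e) * (lmax * P).
  apply: le_trans mu2.
  rewrite [X in X <= _](_ : _ = mu R G * (1 - e) * ((1 - e) * n) ^+ 2); last by ring.
  rewrite ler_wpM2l ?mulr_ge0 ?(ltW e1) //.
  by rewrite ler_pXn2r ?nnegrE ?mulr_ge0 ?(ltW n0) ?(ltW D0) ?(ltW N0) ?(ltW e1).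
(* Origin of 16 and of e <= 1/4: (1 + 16e)(1 - 3e) >= 1 + e amounts to 12e >= 48e^2. *)
have e3 : 1 + e <= (1 + 16 * e) * (1 - e) ^+ 3.
  have : 1 - 3 * e <= (1 - e) ^+ 3.
    rewrite -subr_ge0 (_ : _ - _ = e ^+ 2 * (3 - e)); last by ring.
    by rewrite mulr_ge0 ?sqr_ge0 //; lra.
  by set q := _ ^+ 3; nra.
have q0 : 0 < (1 - e) ^+ 3 * n ^+ 2 by rewrite mulr_gt0 ?exprn_gt0.
rewrite -(ler_pM2r q0); apply: le_trans mu3 _.
rewrite [X in _ <= X](_ : _ = (1 + 16 * e) * (1 - e) ^+ 3 * (lmax * P)); last first.
  by field; rewrite gt_eqF.
by rewrite ler_wpM2r // mulr_ge0 ?(ltW P0).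
Qed.

End Asymptotics.

(** A crude bound valid for every order, so that some finite error is admissible below the threshold
    too. Any nonzero [f] of zero sum would do, since (f u - f v)^2 <= 2 (f u)^2 + 2 (f v)^2. *)
Lemma mu_le_card : mu R G <= 2 * n.
Proof.
move: G_gt1 => /card_gt1P[x [y [_ _ xy]]].
pose f z : R := (z == x)%:R - (z == y)%:R.
have sum1 z : \sum_u (u == z)%:R = 1 :> R.
  rewrite (bigD1 z) //= eqxx big1 ?addr0 // => u /negbTE ->; exact: mulr0n.
have f0 : \sum_u f u = 0 by rewrite sumrB !sum1 subrr.
have q0 : 0 < \sum_u f u ^+ 2.
  rewrite (bigD1 x) //= ltr_pwDl //; last by apply: sumr_ge0 => u _; exact: sqr_ge0.
  by rewrite /f eqxx (negbTE xy) subr0 expr1n.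
rewrite -(ler_pM2r q0); apply: le_trans (mu_le_energy G_gt1 f0) _.
rewrite /energy ler_pdivrMl //.
apply: (@le_trans _ _ (\sum_u \sum_v (2 * f u ^+ 2 + 2 * f v ^+ 2))).
  apply: ler_sum => u _; apply: ler_sum => v _.
  apply: (@le_trans _ _ ((f u - f v) ^+ 2)).
    by rewrite ler_piMl ?sqr_ge0 // lern1 leq_b1.
  by have := sqr_ge0 (f u + f v); lra.
rewrite le_eqVlt; apply/orP; left; apply/eqP.
under eq_bigr => u _ do rewrite big_split sumr_const -mulr_sumr /=.
rewrite big_split sumr_const sumrMnl -mulr_sumr /=.
by rewrite -!(mulr_natr (2 * _)); ring.
Qed.

End LayeredBounds.

(* The error terms are chosen within [1/(n+1)] of the least admissible one. *)
Lemma eventually_small_choice (R : realType) (P : nat -> R -> Prop) :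
  (forall n, exists x, 0 <= x /\ P n x) ->
  (forall e, 0 < e -> exists X : R, forall n, X <= n%:R -> P n e) ->
  exists o : nat -> R, o @ \oo --> (0 : R) /\ forall n, P n (o n).
Proof.
move=> Pex Peps.
have wE n : exists x, [/\ 0 <= x, P n x &
    forall y, 0 <= y -> P n y -> x <= y + n.+1%:R^-1].
  pose E := [set x : R | 0 <= x /\ P n x].
  have [x0 Ex0] := Pex n.
  have hE : has_inf E by split; [exists x0 | exists 0 => y []].
  have n0 : 0 < n.+1%:R^-1 :> R by rewrite invr_gt0 ltr0n.
  have [x [x0' Px] xlt] := inf_adherent n0 hE.
  exists x; split=> // y y0 Py; apply: le_trans (ltW xlt) _.
  by rewrite lerD2r; apply: (ge_inf hE.2); split.
have [w wP] := choice wE.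
exists w; split; last by move=> n; case: (wP n).
apply/cvgrPdist_le => e e0; have e2 : 0 < e / 2 by rewrite divr_gt0.
have [X XP] := Peps _ e2.
near=> n.
have [wn0 _ wnP] := wP n; rewrite sub0r normrN ger0_norm //.
apply: le_trans (wnP _ (ltW e2) (XP n _)) _; first by near: n; exact: nbhs_infty_ger.
rewrite [X in _ <= X](splitr e) lerD2l.
rewrite -[X in _ <= X]invrK lef_pV2 ?posrE ?invr_gt0 ?ltr0n //.
apply: le_trans (_ : n%:R <= _); last by rewrite ler_nat.
by near: n; exact: nbhs_infty_ger.
Unshelve. all: by end_near.
Qed.

(** * The bounds for the family and the choice of the error terms *)

Section Family.
Variables (R : realType) (n d C : nat) (G : sgraph).
Variables (D : family_decomposition n d C G) (L l : nat).
Hypotheses (L_max : is_maximum (abc D) L) (l_min : is_minimum (abc D) l).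

Lemma family_order_gt1 : (1 < #|G|)%N.
Proof.
rewrite (decomposition_card R D) -(order_eq D).
pose i := Ordinal (nmajor_gt0 D).
have [m0 a0 b0 c0] := params_gt0 i; have s := params_sum i.
rewrite (bigD1 i) //=; apply: leq_trans (leq_addr _ _).
by apply: leq_trans (leq_addr _ _); nia.
Qed.

Lemma family_min_gt0 : (0 < l)%N.
Proof.
have [[i <-] _] := l_min; have [_ a0 b0 c0] := params_gt0 i.
by rewrite /abc !muln_gt0 a0 b0 c0.
Qed.

Lemma family_min_le : (l <= d.+1 ^ 3)%N.
Proof.
have [[i <-] _] := l_min; have s := params_sum i.
by rewrite /abc !expnS expn0 muln1 mulnA; apply: leq_mul; [apply: leq_mul|]; lia.
Qed.

Lemma family_layering : inhabited (layering d C (l%:R : R) L%:R G).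
Proof.
refine (@decomposition_layering R _ _ _ _ D _ _ _ _); first by rewrite ltr0n family_min_gt0.
by move=> i; rewrite !ler_nat (proj2 l_min) (proj2 L_max).
Qed.

End Family.

Lemma small_quarter (R : realType) (x : R) : 0 < x ->
  exists e : R, [/\ 0 < e, e <= 4^-1 & 16 * e <= x].
Proof.
move=> x0; exists (Num.min 4^-1 (x / 16)); split.
- by rewrite lt_min invr_gt0 ltr0n divr_gt0.
- by rewrite ge_min lexx.
by rewrite mulrC -ler_pdivlMr // ge_min lexx orbT.
Qed.

Theorem theorem7 (R : realType) (d C : nat) :
  exists o1 o2 : nat -> R,
    [/\ o1 @ \oo --> (0 : R),
        o2 @ \oo --> (0 : R) &
        forall (n : nat) (G : sgraph) (D : family_decomposition n d C G)
               (L l : nat),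
          is_maximum (abc D) L -> is_minimum (abc D) l ->
          (1 + o1 n) * (l%:R * pi ^+ 2 / n%:R ^+ 2) <= mu R G /\
          mu R G <= (1 + o2 n) * (L%:R * pi ^+ 2 / n%:R ^+ 2)].
Proof.
have unit_ge0 k n : 0 <= k%:R * pi ^+ 2 / n%:R ^+ 2 :> R.
  by rewrite divr_ge0 ?exprn_ge0 ?ler0n // mulr_ge0 ?exprn_ge0 ?ler0n ?pi_ge0.
have [w1 [w1_0 w1P]] : exists o : nat -> R, o @ \oo --> (0 : R) /\
    forall n G (D : family_decomposition n d C G) L l,
      is_maximum (abc D) L -> is_minimum (abc D) l ->
      (1 - o n) * (l%:R * pi ^+ 2 / n%:R ^+ 2) <= mu R G.
  apply: (@eventually_small_choice R (fun n x =>
    forall G (D : family_decomposition n d C G) L l,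
      is_maximum (abc D) L -> is_minimum (abc D) l ->
      (1 - x) * (l%:R * pi ^+ 2 / n%:R ^+ 2) <= mu R G)) => [n|x x0].
    (* With error 1 the lower bound reduces to nonnegativity of [mu]. *)
    exists 1; split=> // G D L l Lmax lmin; rewrite subrr mul0r.
    exact: mu_ge0 (family_order_gt1 R D).
  have [e [e0 e4 ex]] := small_quarter x0.
  exists (lower_threshold d C e) => n nX G D L l Lmax lmin.
  have [Lay] := family_layering R Lmax lmin.
  have l0 : 0 < l%:R :> R by rewrite ltr0n (family_min_gt0 lmin).
  have l3 : l%:R <= d.+1%:R ^+ 3 :> R.
    by rewrite -natrX ler_nat (family_min_le lmin).
  have nG := decomposition_card R D; rewrite -nG in nX.
  apply: le_trans (mu_ge_asymptotic Lay l0 (family_order_gt1 R D) e0 e4 l3 nX).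
  by rewrite nG ler_wpM2r // lerB.
have [w2 [w2_0 w2P]] : exists o : nat -> R, o @ \oo --> (0 : R) /\
    forall n G (D : family_decomposition n d C G) L l,
      is_maximum (abc D) L -> is_minimum (abc D) l ->
      mu R G <= (1 + o n) * (L%:R * pi ^+ 2 / n%:R ^+ 2).
  apply: (@eventually_small_choice R (fun n x =>
    forall G (D : family_decomposition n d C G) L l,
      is_maximum (abc D) L -> is_minimum (abc D) l ->
      mu R G <= (1 + x) * (L%:R * pi ^+ 2 / n%:R ^+ 2))) => [n|x x0].
    have p0 : 0 < pi ^+ 2 :> R by rewrite exprn_gt0 ?pi_gt0.
    (* This error times L pi^2 / n^2 equals 2 n L, which dominates the bound 2n of [mu_le_card]
       because L >= 1. *)
    exists (2 * n%:R * (n%:R ^+ 2 / pi ^+ 2)).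
    split; first by rewrite mulr_ge0 ?divr_ge0 ?exprn_ge0 ?mulr_ge0 ?ler0n ?pi_ge0.
    move=> G D L l Lmax lmin.
    have n0 : n%:R != 0 :> R.
      by rewrite -(decomposition_card R D) pnatr_eq0 -lt0n ltnW // (family_order_gt1 R D).
    have L1 : 1 <= L%:R :> R.
      have [i _] := proj1 lmin; rewrite ler1n.
      apply: leq_trans (family_min_gt0 lmin) _.
      by rewrite (leq_trans (proj2 lmin i)) // (proj2 Lmax).
    apply: le_trans (mu_le_card R (family_order_gt1 R D)) _.
    rewrite (decomposition_card R D).
    rewrite [X in _ <= X](_ : _ = L%:R * (pi ^+ 2 / n%:R ^+ 2) + 2 * n%:R * L%:R).
      by rewrite ler_wpDl ?mulr_ge0 ?divr_ge0 ?exprn_ge0 ?pi_ge0 // ler_peMr.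
    have p1 : pi != 0 :> R by rewrite gt_eqF ?pi_gt0.
    by move: (pi : R) p1 => p p1; field; rewrite n0 p1.
  have [e [e0 e4 ex]] := small_quarter x0.
  exists (upper_threshold d C e) => n nX G D L l Lmax lmin.
  have [Lay] := family_layering R Lmax lmin.
  have L0 : 0 <= L%:R :> R by [].
  have l0 : 0 < l%:R :> R by rewrite ltr0n (family_min_gt0 lmin).
  have nG := decomposition_card R D; rewrite -nG in nX.
  apply: le_trans (mu_le_asymptotic Lay L0 (family_order_gt1 R D) e0 e4 nX) _.
  by rewrite nG ler_wpM2r // lerD2l.
exists (fun n => - w1 n), w2; split=> //; first by rewrite -oppr0; exact: cvgN.
by move=> n G D L l Lmax lmin; split; [exact: w1P Lmax lmin | exact: w2P Lmax lmin].
Qed.
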